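(* Let $R$ be a unital Banach algebra with norm $\|\cdot\|$ and identity $I$. Let $A,B,Z\in R$ be (in general noncommuting) parameters and let $Q\in R$ be the base. Suppose that $Q$ and $B$ both commute with each of the other parameters (while $A$ and $Z$ need not commute with each other). Assume that $\|Z\|<1$ and $\|A^{-1}Z^{-1}B\|<1$. Then the following two summations for reversed noncommutative bilateral basic hypergeometric series hold. (Reversed type I) $$ {}_1\psi_1^{\;\sim}\!\left\lceil\!\begin{array}{c}A\\ B\end{array}\!;Q,Z\right\rfloor= {}^{\sim}\!\left\lfloor\!\begin{array}{c}ZA\\ Z\end{array}\!;Q,I\right\rceil_\infty {}^{\sim}\!\left\lceil\!\begin{array}{c}A^{-1}Z^{-1}Q\\ ZA^{-1}Z^{-1}Q\end{array}\!;Q,I\right\rfloor_\infty {}^{\sim}\!\left\lfloor\!\begin{array}{c}ZA^{-1}Z^{-1}B,\;Q\\ A^{-1}Z^{-1}B,\;B\end{array}\!;Q,I\right\rceil_\infty . $$ (Reversed type II) $$ {}_1\psi_1^{\;\sim}\!\left\lfloor\!\begin{array}{c}A\\ B\end{array}\!;Q,Z\right\rceil= \left\lfloor\!\begin{array}{c}A^{-1}B\\ A^{-1}Z^{-1}B\end{array}\!;Q,I\right\rceil_\infty {}^{\sim}\!\left\lfloor\!\begin{array}{c}Q,\;A^{-1}Z^{-1}Q\\ A^{-1}Q,\;B\end{array}\!;Q,I\right\rceil_\infty \left\lfloor\!\begin{array}{c}ZA\\ Z\end{array}\!;Q,I\right\rceil_\infty . $$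
   Context: $R$ is a unital Banach algebra with norm $\|\cdot\|$ and identity $I$; its elements do not commute in general. The base $Q\in R$ commutes with all other parameters that appear (for instance $Q=qI$, $q$ a scalar). All expressions that appear are implicitly assumed to be well defined; in particular, whenever an inverse $X^{-1}$ is written (also inside the definitions below, including the products with negative index and the negative powers of $Q$ in them), its existence is assumed. Ordered products. For integers $l,m$, $$\prod_{j=l}^m X_j=\begin{cases} I & m=l-1,\\ X_lX_{l+1}\cdots X_m & m\ge l,\\ X_{l-1}^{-1}X_{l-2}^{-1}\cdots X_{m+1}^{-1} & m<l-1.\end{cases}$$ Products $\prod_{i=1}^r$ are ordered in the same way, with $i$ increasing from left to right. Noncommutative $Q$-shifted factorials. For an integer $k$ (possibly negative): type II: $$\left\lfloor\!\begin{array}{c}A_1,\dots,A_r\\ B_1,\dots,B_r\end{array}\!;Q,Z\right\rceil_k=\prod_{j=1}^k\left[\left(\prod_{i=1}^r(I-B_iQ^{j-1})^{-1}(I-A_iQ^{j-1})\right)Z\right];$$ reversed type I: $${}^{\sim}\!\left\lceil\!\begin{array}{c}A_1,\dots,A_r\\ B_1,\dots,B_r\end{array}\!;Q,Z\right\rfloor_k=\prod_{j=1}^k\left(Z\prod_{i=1}^r(I-A_iQ^{j-1})(I-B_iQ^{j-1})^{-1}\right);$$ reversed type II: $${}^{\sim}\!\left\lfloor\!\begin{array}{c}A_1,\dots,A_r\\ B_1,\dots,B_r\end{array}\!;Q,Z\right\rceil_k=\prod_{j=1}^k\left(Z\prod_{i=1}^r(I-A_iQ^{k-j})(I-B_iQ^{k-j})^{-1}\right).$$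 For $k=\infty$ these denote the limits in $R$ as $k\to\infty$ of the corresponding expressions. Reversed noncommutative bilateral basic hypergeometric series of type I and type II: $${}_1\psi_1^{\;\sim}\!\left\lceil\!\begin{array}{c}A\\ B\end{array}\!;Q,Z\right\rfloor=\sum_{k=-\infty}^{\infty}{}^{\sim}\!\left\lceil\!\begin{array}{c}A\\ B\end{array}\!;Q,Z\right\rfloor_k,\qquad {}_1\psi_1^{\;\sim}\!\left\lfloor\!\begin{array}{c}A\\ B\end{array}\!;Q,Z\right\rceil=\sum_{k=-\infty}^{\infty}{}^{\sim}\!\left\lfloor\!\begin{array}{c}A\\ B\end{array}\!;Q,Z\right\rceil_k .$$
   Formalization: The base Q is additionally assumed to satisfy Q^n → 0 (for instance ‖Q‖ < 1); without such a condition, e.g. for Q = I, the bilateral series diverges although both norm conditions hold. Convergence of the series and of all the infinite products is then part of the conclusion. *)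

(* Defs.v *)
From HB Require Import structures.
From mathcomp Require Import all_boot all_order all_algebra.
From mathcomp Require Import all_classical all_reals all_analysis.

Set Implicit Arguments.
Unset Strict Implicit.
Unset Printing Implicit Defensive.

Import Order.TTheory GRing.Theory Num.Theory.
Import numFieldNormedType.Exports.

Local Open Scope classical_set_scope.
Local Open Scope ring_scope.

(* The hierarchy has no join of normed modules and rings that are not number
   domains, so the multiplication is added to a Banach space by hand and the
   ring structure is then declared on the carrier. The normalization
   [`|1| = 1] is not imposed. A complex Banach algebra is in particular a
   real one. *)
Record banachAlgType (K : realType) := BanachAlg {
  banach_space : completeNormedModType K ;
  banach_one : banach_space ;
  banach_mul : banach_space -> banach_space -> banach_space ;
  banach_mulA : associative banach_mul ;
  banach_1mul : left_id banach_one banach_mul ;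
  banach_mul1 : right_id banach_one banach_mul ;
  banach_mulDl : left_distributive banach_mul +%R ;
  banach_mulDr : right_distributive banach_mul +%R ;
  banach_one_neq0 : banach_one != 0 ;
  banach_scaleAl : forall (a : K) x y,
    a *: banach_mul x y = banach_mul (a *: x) y ;
  banach_scaleAr : forall (a : K) x y,
    a *: banach_mul x y = banach_mul x (a *: y) ;
  banach_normM : forall x y, `|banach_mul x y| <= `|x| * `|y|
}.

Definition banach_sort (K : realType) (R : banachAlgType K) : Type :=
  banach_space R.
Coercion banach_sort : banachAlgType >-> Sortclass.

Section BanachAlgebra.
Context (K : realType) (R : banachAlgType K).

HB.instance Definition _ := CompleteNormedModule.copy (banach_sort R) (banach_space R).

HB.instance Definition _ := GRing.Zmodule_isNzRing.Build (banach_sort R)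
  (@banach_mulA K R) (@banach_1mul K R) (@banach_mul1 K R)
  (@banach_mulDl K R) (@banach_mulDr K R) (@banach_one_neq0 K R).

HB.instance Definition _ := GRing.Lmodule_isLalgebra.Build K (banach_sort R)
  (@banach_scaleAl K R).

HB.instance Definition _ := GRing.Lalgebra_isAlgebra.Build K (banach_sort R)
  (@banach_scaleAr K R).

Definition banach_inverse (x y : R) : Prop := y * x = 1 /\ x * y = 1.
Definition banach_unit (x : R) : bool := `[< exists y, banach_inverse x y >].
Definition banach_inv (x : R) : R :=
  if pselect (exists y, banach_inverse x y) is left e then projT1 (cid e) else x.

Lemma banach_invP (x : R) : banach_unit x -> banach_inverse x (banach_inv x).
Proof. by move=> /asboolP xu; rewrite /banach_inv; case: pselect => // e; case: cid. Qed.

Fact banach_mulVr : {in banach_unit, left_inverse 1 banach_inv *%R}.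
Proof. by move=> x /banach_invP[]. Qed.

Fact banach_divrr : {in banach_unit, right_inverse 1 banach_inv *%R}.
Proof. by move=> x /banach_invP[]. Qed.

Fact banach_unitrP (x y : R) : y * x = 1 /\ x * y = 1 -> banach_unit x.
Proof. by move=> xy; apply/asboolP; exists y. Qed.

Fact banach_invr_out : {in [predC banach_unit], banach_inv =1 id}.
Proof. by move=> x /asboolP xNu; rewrite /banach_inv; case: pselect. Qed.

HB.instance Definition _ := GRing.NzRing_hasMulInverse.Build (banach_sort R)
  banach_mulVr banach_divrr banach_unitrP banach_invr_out.

Lemma ler_normM (x y : R) : `|x * y| <= `|x| * `|y|.
Proof. exact: banach_normM. Qed.

End BanachAlgebra.

(* The product of the [X j], [l <= j <= m], increasing from left to right; for
   [m < l - 1] it is [(X (l-1))^-1 * (X (l-2))^-1 * ... * (X (m+1))^-1]. *)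
Definition oprod (R : unitRingType) (X : int -> R) (l m : int) : R :=
  if l - 1 <= m
  then \prod_(0 <= i < `|(m + 1 - l)%R|%N) X (l + i%:Z)
  else \prod_(0 <= i < `|(l - 1 - m)%R|%N) (X (l - 1 - i%:Z))^-1.

Section ShiftedFactorials.
Context (R : unitRingType) (r : nat).
Implicit Types (A B : r.-tuple R) (Q Z : R) (k : int).

Definition qfact_II A B Q Z k : R :=
  oprod (fun j => (\prod_(i < r) ((1 - tnth B i * Q ^ (j - 1))^-1
                                  * (1 - tnth A i * Q ^ (j - 1)))) * Z) 1 k.

Definition qfact_revI A B Q Z k : R :=
  oprod (fun j => Z * \prod_(i < r) ((1 - tnth A i * Q ^ (j - 1))
                                     * (1 - tnth B i * Q ^ (j - 1))^-1)) 1 k.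

Definition qfact_revII A B Q Z k : R :=
  oprod (fun j => Z * \prod_(i < r) ((1 - tnth A i * Q ^ (k - j))
                                     * (1 - tnth B i * Q ^ (k - j))^-1)) 1 k.

End ShiftedFactorials.

Section Infinite.
Context (K : realType) (R : banachAlgType K).

(* The value at infinity of [f : int -> R]; meaningful when [cvg_infty f]. *)
Definition cvg_infty (f : int -> R) : Prop := cvgn (fun n : nat => f n%:Z).
Definition at_infty (f : int -> R) : R := limn (fun n : nat => f n%:Z).

(* The halves [k >= 0] and [k < 0] of a bilateral series are summed separately;
   [Negz n] is [- n.+1]. *)
Definition bilateral_cvg (f : int -> R) : Prop :=
  cvgn (series (fun n : nat => f n%:Z)) /\ cvgn (series (fun n : nat => f (Negz n))).
Definition bilateral_sum (f : int -> R) : R :=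
  limn (series (fun n : nat => f n%:Z)) + limn (series (fun n : nat => f (Negz n))).

Definition psi_revI (A B Q Z : R) : R :=
  bilateral_sum (qfact_revI [tuple A] [tuple B] Q Z).
Definition psi_revII (A B Q Z : R) : R :=
  bilateral_sum (qfact_revII [tuple A] [tuple B] Q Z).

End Infinite.

(* Main.v *)
Require Import Defs.
From HB Require Import structures.
From mathcomp Require Import all_boot all_order all_algebra.
From mathcomp Require Import all_classical all_reals all_analysis.
From mathcomp Require Import ring lra.

Set Implicit Arguments.
Unset Strict Implicit.
Unset Printing Implicit Defensive.

Import Order.TTheory GRing.Theory Num.Theory.
Import numFieldNormedType.Exports.

Local Open Scope classical_set_scope.
Local Open Scope ring_scope.

(* Both series have the form sum_k c_k with c_{k+1} = c_k (C - D Q^k) / (1 - b Q^k),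
   where C = Z and D = Z A; for the second one products are taken in the opposite
   algebra. Eliminating Q^k between the recurrence for c_k and the relation
   c_k(bQ) (1 - b Q^k) = c_k(b) (1 - b) yields a two-term contiguous relation
     f(b) (1 - D^-1 b) (1 - b) = f(bQ) (1 - C D^-1 b)
   for the sum f(b). Iterated from b = B and from b = Q it expresses both f(B) and
   f(Q) through f(0) = lim f(b Q^N). At b = Q the series is one-sided and is summed
   by the q-binomial theorem, which gives f(0), hence f(B). No inverse of f(0) or of
   1 - D^-1 Q^n is needed, because f(0) only enters through the vanishing difference
   f(B Q^N) - f(Q^(N+1)). *)

(** * Series in complete normed modules *)

(** The obstacle is that [C] and [D] do not commute, so products in them cannot be rearranged as in
    the classical proof of Ramanujan's sum. Since [b] and [Q] commute with each other and with [C]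
    and [D], the factors 1 - b Q^k and 1 - Q^k can be moved freely, and only the factors that
    involve [C] or [D] keep their place. Each elementary step of the proof is arranged so that
    nothing else has to move. The only size condition on the base is that Q^n tends to 0; the norm
    of [Q] itself may exceed 1. For this reason convergence estimates refer to a high power of [Q],
    and summability of the negative half is carried along as a property instead of being deduced
    from a norm each time [b] is replaced by b Q. *)

Lemma series_shift (V : zmodType) (u : V^nat) (p n : nat) :
  series u (n + p)%N = series u p + series (fun k => u (k + p)%N) n.
Proof.
rewrite /series /= (@big_cat_nat _ _ _ p) ?leq_addl//=; congr (_ + _).
by rewrite -{1}(add0n p) big_addn addnK.
Qed.

Lemma cvgn_series_shift (K : numFieldType) (V : normedModType K) (u : V^nat) (p : nat) :
  cvgn (series (fun k => u (k + p)%N)) -> cvgn (series u).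
Proof.
move=> cu; suff : (fun n => series u (n + p)%N) @ \oo -->
    series u p + limn (series (fun k => u (k + p)%N)).
  by rewrite (@cvg_shiftn p _ (series u)) => /cvgP.
under eq_fun do rewrite series_shift.
by apply: cvgD => //; exact: cvg_cst.
Qed.

(** Terms are compared [p] indices apart because this is what Q^n tending to 0 provides: some power
    of [Q] has small norm, while a single multiplication by [Q] may increase norms. *)
Lemma normal_cvg_ratio (K : realType) (V : completeNormedModType K) (u : V^nat)
    (r : K) (p M : nat) : 0 <= r < 1 ->
  (forall n, (M <= n)%N -> `|u (n + p)%N| <= r * `|u n|) ->
  cvgn (series (fun n => `|u n|)).
Proof.
move=> /andP[r0 r1] ur; apply: (@cvgn_series_shift _ K^o _ M).
set v := fun k => `|u (k + M)%N|.
have v0 n : 0 <= v n by exact: normr_ge0.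
have nd : nondecreasing_seq (series v) by apply: nondecreasing_series.
(* The partial sums S_n of [v] satisfy S_n <= S_(n+p) <= S_p + r S_n, hence S_n <= S_p / (1 - r). *)
apply: nondecreasing_is_cvgn => //; exists (series v p / (1 - r)) => _ [n _ <-].
rewrite ler_pdivlMr ?subr_gt0// mulrBr mulr1 lerBlDr.
rewrite (le_trans (nd n (n + p)%N _)) ?leq_addr// series_shift lerD2l mulrC.
rewrite /series /= mulr_sumr ler_sum// => i _.
by rewrite /v addnAC; apply: ur; rewrite leq_addl.
Qed.

Lemma cvgn_ratio (K : realType) (V : completeNormedModType K) (u : V^nat)
    (r : K) (M : nat) : 0 <= r < 1 ->
  (forall n, (M <= n)%N -> `|u n.+1| <= r * `|u n|) -> cvgn (series u).
Proof.
move=> r01 ur; apply/normed_cvg/(@normal_cvg_ratio _ _ _ r 1 M) => // n.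
by rewrite addn1; exact: ur.
Qed.

Lemma ratio_tail (K : realType) (V : completeNormedModType K) (u : V^nat)
    (r : K) (M : nat) : 0 <= r < 1 ->
  (forall n, (M <= n)%N -> `|u n.+1| <= r * `|u n|) ->
  `|limn (series u) - series u M| <= `|u M| / (1 - r).
Proof.
move=> r01 ur; have /andP[r0 r1] := r01.
have cu := cvgn_ratio r01 ur.
set v := fun k => u (k + M)%N.
have geo n : `|v n| <= `|u M| * r ^+ n.
  elim: n => [|n IH]; first by rewrite /v add0n expr0 mulr1.
  rewrite /v addSn (le_trans (ur _ _)) ?leq_addl// exprS mulrCA.
  by rewrite ler_wpM2l.
have bnd n : `|series u (n + M)%N - series u M| <= `|u M| / (1 - r).
  rewrite series_shift addrC addKr /series /=.
  rewrite (le_trans (ler_norm_sum _ _ _))//.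
  rewrite (@le_trans _ _ (\sum_(0 <= i < n) `|u M| * r ^+ i))//.
    by apply: ler_sum => i _; exact: geo.
  rewrite -mulr_sumr ler_wpM2l// ?normr_ge0//.
  rewrite -(ler_pM2r (_ : 0 < 1 - r)) ?subr_gt0// mulVf ?lt0r_neq0 ?subr_gt0//.
  have -> : (\sum_(0 <= i < n) r ^+ i) * (1 - r) = 1 - r ^+ n.
    elim: n {geo} => [|n IH]; first by rewrite big_geq// mul0r expr0 subrr.
    by rewrite big_nat_recr//= mulrDl IH exprS; ring.
  by rewrite gerBl exprn_ge0.
have cv : (fun n => `|series u (n + M)%N - series u M|) @ \oo -->
    `|limn (series u) - series u M|.
  apply: cvg_norm; apply: cvgB; last exact: cvg_cst.
  by rewrite (@cvg_shiftn M _ (series u)).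
rewrite -(cvg_lim _ cv)//; apply: limr_le; first exact: cvgP cv.
by apply: nearW => n; exact: bnd.
Qed.

(** A ratio bound uniform in [N] replaces the summable majorant of Tannery's theorem. It bounds the
    tail after index n by |t N n| / (1 - r), and t N n is eventually close to the small number s
    n. *)
Lemma tannery_ratio (K : realType) (V : completeNormedModType K)
    (t : nat -> V^nat) (s : V^nat) (r : K) (M N0 : nat) : 0 <= r < 1 ->
  (forall N k, (N0 <= N)%N -> (M <= k)%N -> `|t N k.+1| <= r * `|t N k|) ->
  (forall k, t N k @[N --> \oo] --> s k) ->
  limn (series (t N)) @[N --> \oo] --> limn (series s).
Proof.
move=> r01 tr ts; have /andP[r0 r1] := r01.
have sr k : (M <= k)%N -> `|s k.+1| <= r * `|s k|.
  move=> Mk.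
  have c1 : (fun N => `|t N k.+1|) @ \oo --> `|s k.+1| by exact: cvg_norm.
  have c2 : (fun N => r * `|t N k|) @ \oo --> r * `|s k|.
    by apply: cvgMr; exact: (cvg_norm (ts k)).
  apply: ler_cvg_to c1 c2 _.
  by exists N0 => // N /= N0N; exact: tr.
have s0 : s @ \oo --> 0 by apply: cvg_series_cvg_0; exact: cvgn_ratio sr.
have r1' : 0 < 1 - r by rewrite subr_gt0.
apply/cvgrPdist_le => e e0.
(* Error budget: e/4 for the tail of [s], e/4 for the two partial sums, and e/2 for the tail of
   [t N], since |t N n| is at most twice e/4 (1 - r). *)
have e4 : 0 < e / 4 * (1 - r) by rewrite mulr_gt0// divr_gt0.
have [n nM sn] : exists2 n, (M <= n)%N & `|s n| <= e / 4 * (1 - r).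
  have /cvgr0Pnorm_le/(_ _ e4)[n1 _ n1P] := s0.
  by exists (maxn M n1); rewrite ?leq_maxl//; apply: n1P; rewrite /= leq_maxr.
have cS : series (t N) n @[N --> \oo] --> series s n.
  elim: n {nM sn} => [|n IH].
    by rewrite /series /= big_geq//; under eq_fun do rewrite big_geq//; exact: cvg_cst.
  by rewrite seriesSr; under eq_fun do rewrite seriesSr; apply: cvgD => //; exact: ts.
have e40 : 0 < e / 4 by rewrite divr_gt0.
have /cvgrPdist_le/(_ _ e40)[N1 _ N1P] := cS.
have /cvgrPdist_le/(_ _ e4)[N2 _ N2P] := ts n.
exists (maxn N0 (maxn N1 N2)) => // N /=; rewrite !geq_max => /and3P[h0 h1 h2].
have := N1P _ h1; have := N2P _ h2 => /= tn Sn.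
have b1 : `|limn (series s) - series s n| <= e / 4.
  apply: le_trans (ratio_tail r01 _) _ => [k nk|]; first by apply: sr; exact: leq_trans nk.
  by rewrite ler_pdivrMr.
have tn2 : `|t N n| <= e / 4 * (1 - r) * 2.
  have -> : t N n = s n - (s n - t N n) by rewrite subKr.
  by rewrite (le_trans (ler_normB _ _))//; lra.
have b2 : `|limn (series (t N)) - series (t N) n| <= e / 4 * 2.
  apply: le_trans (ratio_tail r01 _) _ => [k nk|]; first by apply: tr => //; exact: leq_trans nk.
  by rewrite ler_pdivrMr// mulrAC.
have -> : limn (series s) - limn (series (t N)) =
  (limn (series s) - series s n) + (series s n - series (t N) n)
   - (limn (series (t N)) - series (t N) n).
  by rewrite addrA subrK opprB addrA subrK.
rewrite (le_trans (ler_normB _ _))//.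
have := ler_normD (limn (series s) - series s n) (series s n - series (t N) n).
lra.
Qed.

(** A discrete Gronwall argument: 1 + a <= exp a bounds |x n| by |x 0| exp (sum of a), so the
    increments are absolutely summable. It yields convergence of infinite products without
    logarithms, which noncommuting factors would not allow. *)
Lemma cvgn_perturb (K : realType) (V : completeNormedModType K) (x : V^nat) (a : K^nat) :
  (forall n, 0 <= a n) -> cvgn (series a) ->
  (forall n, `|x n.+1 - x n| <= a n * `|x n|) -> cvgn x.
Proof.
move=> a0 ca xa.
have le_a n : series a n <= limn (series a).
  by apply: nondecreasing_cvgn_le => //; exact: nondecreasing_series.
have bx n : `|x n| <= `|x 0%N| * expR (series a n).
  elim: n => [|n IH]; first by rewrite /series /= big_geq// expR0 mulr1.
  rewrite seriesSr expRD mulrA.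
  have -> : x n.+1 = x n + (x n.+1 - x n) by rewrite addrC subrK.
  rewrite (le_trans (ler_normD _ _))// (@le_trans _ _ (`|x n| * (1 + a n)))//.
    by rewrite mulrDr mulr1 lerD2l mulrC.
  by apply: ler_pM => //; rewrite ?addr_ge0// expR_ge1Dx.
set B := `|x 0%N| * expR (limn (series a)).
have cd : cvgn (series (fun n => `|x n.+1 - x n|)).
  apply: (@series_le_cvg _ _ (B *: (a : K^o^nat))) => //.
  - by move=> n; rewrite /= mulr_ge0// mulr_ge0// expR_ge0.
  - move=> n; rewrite (le_trans (xa n))// mulrC [leRHS]/=.
    apply: ler_wpM2r => //; rewrite (le_trans (bx n))// ler_wpM2l//.
    by rewrite ler_expR.
  - exact: is_cvg_seriesZ.
have /cvg_ex[l cl] := normed_cvg (cd : cvgn [normed series (telescope x)]).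
apply/cvg_ex; exists (x 0%N + l).
have cx : (fun n => x 0%N + series (telescope x) n) @ \oo --> x 0%N + l.
  by apply: cvgD => //; exact: cvg_cst.
by apply: cvg_trans cx; under eq_fun do rewrite -eq_sum_telescope.
Qed.

(** * Banach algebras *)

Lemma cvg_dist_squeeze (K : realType) (V : normedModType K) (u : V^nat) (l : V) (b : K^nat) :
  (\forall n \near \oo, `|u n - l| <= b n) -> b @ \oo --> (0 : K) -> u @ \oo --> l.
Proof.
move=> ub b0; apply/cvgrPdist_le => e e0.
have /cvgr0Pnorm_le/(_ _ e0) := b0; apply: filterS2 ub => n /= un bn.
by rewrite distrC (le_trans un)// (le_trans (ler_norm _)).
Qed.

Section BanachAlgebraTheory.
Context (K : realType) (R : banachAlgType K).
Implicit Types (x y : R) (u v : nat -> R).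

Lemma banach_cvgM u v x y :
  u @ \oo --> x -> v @ \oo --> y -> (fun n => u n * v n) @ \oo --> x * y.
Proof.
move=> ux vy.
have h : (fun n => `|u n| * `|v n - y| + `|u n - x| * `|y|) @ \oo --> (0 : K).
  rewrite -(addr0 0) -[X in X + _](mulr0 `|x|) -[X in _ + X](mul0r `|y|).
  apply: cvgD; apply: cvgM; first exact: cvg_norm.
  - by rewrite -(normr0 R) -(subrr y); apply: cvg_norm; apply: cvgB => //; exact: cvg_cst.
  - by rewrite -(normr0 R) -(subrr x); apply: cvg_norm; apply: cvgB => //; exact: cvg_cst.
  - exact: cvg_cst.
apply: cvg_dist_squeeze h; apply: nearW => n.
have -> : u n * v n - x * y = u n * (v n - y) + (u n - x) * y.
  by rewrite mulrBr mulrBl addrA subrK.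
by rewrite (le_trans (ler_normD _ _))// lerD// ler_normM.
Qed.

Lemma banach_cvgMl u x y : u @ \oo --> x -> (fun n => u n * y) @ \oo --> x * y.
Proof. by move=> ux; apply: banach_cvgM => //; exact: cvg_cst. Qed.

Lemma banach_cvgMr u x y : u @ \oo --> x -> (fun n => y * u n) @ \oo --> y * x.
Proof. by move=> ux; apply: banach_cvgM => //; exact: cvg_cst. Qed.

(** Once |1 - u n| <= 1/2, the two estimates [le1] and [le2] together give |(u n)^-1| <= 2 |1|. The
    factor |1| remains because the norm of the identity is not normalized. *)
Lemma banach_cvgV1 u : u @ \oo --> (1 : R) -> (forall n, u n \is a GRing.unit) ->
  (fun n => (u n)^-1) @ \oo --> (1 : R).
Proof.
move=> u1 uu.
have d0 : (fun n => `|1 - u n|) @ \oo --> (0 : K).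
  by rewrite -(normr0 R) -(subrr 1); apply: cvg_norm; apply: cvgB => //; exact: cvg_cst.
have h : (fun n => 2 * `|1 : R| * `|1 - u n|) @ \oo --> (0 : K).
  by rewrite -(mulr0 (2 * `|1 : R|)); apply: cvgMr.
apply: cvg_dist_squeeze h.
have half_gt0 : 0 < 2^-1 :> K by rewrite invr_gt0.
have /cvgr0Pnorm_le/(_ _ half_gt0) := d0.
apply: filterS => n; rewrite /= normr_id => dn.
have eV : (u n)^-1 - 1 = (u n)^-1 * (1 - u n) by rewrite mulrBr mulr1 mulVr.
have le1 : `|(u n)^-1 - 1| <= `|(u n)^-1| * `|1 - u n| by rewrite eV ler_normM.
have le2 : `|(u n)^-1| <= `|(u n)^-1 - 1| + `|1 : R|.
  by rewrite -{1}((subrK 1 (u n)^-1)) ler_normD.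
have := normr_ge0 (1 - u n); have := normr_ge0 (u n)^-1.
have := normr_ge0 ((u n)^-1 - 1); have := normr_ge0 (1 : R).
nra.
Qed.

Lemma banach_cvgV u x : x \is a GRing.unit -> u @ \oo --> x ->
  (forall n, u n \is a GRing.unit) -> (fun n => (u n)^-1) @ \oo --> x^-1.
Proof.
move=> xu ux uu.
have h : (fun n => (x^-1 * u n)^-1 * x^-1) @ \oo --> 1 * x^-1.
  apply: banach_cvgMl; apply: banach_cvgV1.
    by rewrite -(mulVr xu); exact: banach_cvgMr.
  by move=> n; rewrite unitrMl ?unitrV.
suff -> : (fun n => (u n)^-1) = (fun n => (x^-1 * u n)^-1 * x^-1) by rewrite -[X in _ --> X]mul1r.
by apply/funext => n; rewrite invrM ?unitrV// invrK mulrK.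
Qed.

Lemma banach_bounded u x : u @ \oo --> x -> exists2 L : K, 0 <= L & forall n, `|u n| <= L.
Proof.
move=> ux; have /cvg_has_ub[L LP] : cvgn (fun n => `|u n|).
  by apply/cvg_ex; exists `|x|; exact: cvg_norm.
have LP' n : `|u n| <= L by rewrite -(normr_id (u n)); apply: LP => /=; exists n.
by exists L => //; rewrite (le_trans _ (LP' 0%N)).
Qed.

Lemma unit_1sub x : `|x| < 1 -> 1 - x \is a GRing.unit.
Proof.
move=> x1.
have cx : cvgn (series (GRing.exp x)).
  apply: (@cvgn_ratio _ _ _ `|x| 0%N); first by rewrite normr_ge0.
  by move=> n _; rewrite exprS ler_normM.
have x0 : GRing.exp x @ \oo --> 0 by exact: cvg_series_cvg_0.
set y := limn _ in cx.
have c1 : (fun n => 1 - x ^+ n) @ \oo --> (1 : R).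
  by rewrite -[X in _ --> X]subr0; apply: cvgB => //; exact: cvg_cst.
have eS n : (1 - x) * series (GRing.exp x) n = 1 - x ^+ n.
  rewrite /series /= big_mkord -[1 - x]opprB mulNr -subrX1 opprB//.
have eS' n : series (GRing.exp x) n * (1 - x) = 1 - x ^+ n.
  rewrite -eS; apply/esym/commr_sum => i _.
  by apply/commrX/commr_sym/commrB => //; exact: commr1.
apply/unitrP; exists (limn (series (GRing.exp x))); split.
- have := @banach_cvgMl _ _ (1 - x) cx.
  by under eq_fun do rewrite eS'; move/cvg_unique; apply.
- have := @banach_cvgMr _ _ (1 - x) cx.
  by under eq_fun do rewrite eS; move/cvg_unique; apply.
Qed.

End BanachAlgebraTheory.

(** * Powers of [Q] and convergence of infinite q-products *)

Section VanishingPowers.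
Context (K : realType) (R : banachAlgType K) (Q : R).
Hypothesis Q_to0 : (Q ^+ n) @[n --> \oo] --> (0 : R).

Lemma cvgn_series_norm_expr : cvgn (series (fun n => `|Q ^+ n|)).
Proof.
have half_gt0 : 0 < 2^-1 :> K by rewrite invr_gt0.
have /cvgr0Pnorm_le/(_ _ half_gt0)[p _ /(_ p (leqnn p)) Qp] := Q_to0.
apply: (@normal_cvg_ratio _ _ _ 2^-1 p 0%N); first by lra.
move=> n _; rewrite addnC exprD (le_trans (ler_normM _ _))//.
by rewrite ler_wpM2r.
Qed.

(** For large p the Neumann series inverts 1 - x^p with x = Q^m. This element is the product of 1 -
    x and a commuting geometric sum, so 1 - x is invertible too. *)
Lemma unit_1sub_expr m : (0 < m)%N -> 1 - Q ^+ m \is a GRing.unit.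
Proof.
move=> m0; have one_gt0 : 0 < 1 :> K by [].
have /cvgr0Pnorm_lt/(_ _ one_gt0)[p _ pP] := Q_to0.
have /unit_1sub : `|Q ^+ m ^+ p| < 1 by rewrite -exprM; apply: pP => /=; exact: leq_pmull.
rewrite -[1 - _]opprB subrX1 -mulNr opprB unitrM_comm => [/andP[]//|].
apply: commr_sum => i _.
by apply/commrX/commr_sym/commrB => //; exact: commr1.
Qed.

Lemma cvg_1subMexpr a : (fun n => 1 - a * Q ^+ n) @ \oo --> (1 : R).
Proof.
rewrite -[X in _ --> X]subr0 -(mulr0 a).
by apply: cvgB; [exact: cvg_cst|exact: banach_cvgMr].
Qed.

Lemma cvg_V1subMexpr b : (forall n, 1 - b * Q ^+ n \is a GRing.unit) ->
  (fun n => (1 - b * Q ^+ n)^-1) @ \oo --> (1 : R).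
Proof. by move=> ub; apply: banach_cvgV1 => //; exact: cvg_1subMexpr. Qed.

(** The deviation of a factor from 1 is exactly (b - a) Q^n (1 - b Q^n)^-1, and the last inverse
    stays bounded since it tends to 1. No commutation of [a] or [b] is used. *)
Lemma qfactor_summable a b : (forall n, 1 - b * Q ^+ n \is a GRing.unit) ->
  exists c : K^nat, [/\ forall n, 0 <= c n, cvgn (series c) &
    forall n, `|(1 - a * Q ^+ n) * (1 - b * Q ^+ n)^-1 - 1| <= c n].
Proof.
move=> ub; have [L L0 LP] := banach_bounded (cvg_V1subMexpr ub).
exists ((`|b - a| * L) *: ((fun n => `|Q ^+ n|) : K^o^nat)); split.
- by move=> n; rewrite mulr_ge0// mulr_ge0.
- by apply: is_cvg_seriesZ; exact: cvgn_series_norm_expr.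
- move=> n; have -> : (1 - a * Q ^+ n) * (1 - b * Q ^+ n)^-1 - 1 =
      (b - a) * Q ^+ n * (1 - b * Q ^+ n)^-1.
    rewrite -[X in _ - X](mulrV (ub n)) -mulrBl opprB addrC addrA subrK.
    by rewrite -mulrBl.
  rewrite (le_trans (ler_normM _ _))//= (le_trans (ler_pM _ _ (ler_normM _ _) (LP n)))//.
  by rewrite mulrAC.
Qed.

(** Both this version and the next are required: the type I products grow on the right, the reversed
    type II products on the left. *)
Lemma cvgn_qprod_r a b (x : nat -> R) : (forall n, 1 - b * Q ^+ n \is a GRing.unit) ->
  (forall n, x n.+1 = x n * ((1 - a * Q ^+ n) * (1 - b * Q ^+ n)^-1)) -> cvgn x.
Proof.
move=> /(qfactor_summable a)[c [c0 cc cP]] xS; apply: cvgn_perturb c0 cc _ => n.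
rewrite xS -[X in _ - X]mulr1 -mulrBr (le_trans (ler_normM _ _))// mulrC.
exact: ler_wpM2r.
Qed.

Lemma cvgn_qprod_l a b (x : nat -> R) : (forall n, 1 - b * Q ^+ n \is a GRing.unit) ->
  (forall n, x n.+1 = (1 - a * Q ^+ n) * (1 - b * Q ^+ n)^-1 * x n) -> cvgn x.
Proof.
move=> /(qfactor_summable a)[c [c0 cc cP]] xS; apply: cvgn_perturb c0 cc _ => n.
rewrite xS -[X in _ - X]mul1r -mulrBl (le_trans (ler_normM _ _))//.
exact: ler_wpM2r.
Qed.

End VanishingPowers.

(** * Contiguous relations for the bilateral series *)

Section SeriesInBanachAlgebra.
Context (K : realType) (R : banachAlgType K).
Implicit Types (u v w : nat -> R).

Lemma cvg_seriesMl u (l y : R) :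
  series u @ \oo --> l -> series (fun k => u k * y) @ \oo --> l * y.
Proof.
move=> ul; have := @banach_cvgMl _ _ _ _ y ul.
by rewrite /series /=; under eq_fun do rewrite mulr_suml.
Qed.

Lemma cvg_seriesB u v (l m : R) : series u @ \oo --> l -> series v @ \oo --> m ->
  series (fun k => u k - v k) @ \oo --> l - m.
Proof.
move=> ul vm; have -> : series (fun k => u k - v k) = (fun n => series u n - series v n).
  by apply/funext => n; rewrite /series /= sumrB.
exact: cvgB.
Qed.

Lemma cvg_seriesS u (l : R) :
  series u @ \oo --> l -> series (fun k => u k.+1) @ \oo --> l - u 0%N.
Proof.
move=> ul; have ulS : (fun n => series u n.+1) @ \oo --> l by rewrite cvg_shiftS.
have -> : series (fun k => u k.+1) = (fun n => series u n.+1 - u 0%N).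
  by apply/funext => n; rewrite /series /= big_nat_recl//= addrC addKr.
by apply: cvgB => //; exact: cvg_cst.
Qed.

Lemma cvg_seriesSV u (l : R) :
  series (fun k => u k.+1) @ \oo --> l -> series u @ \oo --> u 0%N + l.
Proof.
move=> ul; rewrite -(cvg_shiftS (series u)).
have -> : (fun n => series u n.+1) = (fun n => u 0%N + series (fun k => u k.+1) n).
  by apply/funext => n; rewrite /series /= big_nat_recl.
by apply: cvgD => //; exact: cvg_cst.
Qed.

Lemma normal_cvg_dominated u v (L : K) : cvgn (series (fun n => `|u n|)) ->
  (forall n, `|v n| <= L * `|u n|) -> cvgn (series (fun n => `|v n|)).
Proof.
move=> cu vu; apply: (@series_le_cvg _ _ (L *: ((fun n => `|u n|) : K^o^nat))) => //.
- by move=> n; rewrite (le_trans _ (vu n)).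
- exact: is_cvg_seriesZ.
Qed.

Lemma normal_cvg_factor u w (l : R) : w @ \oo --> l -> `|l| < 1 ->
  (forall n, u n.+1 = u n * w n) -> cvgn (series (fun n => `|u n|)).
Proof.
move=> wl l1 uS; have lr : `|l| < (1 + `|l|) / 2 by lra.
have [M _ MP] := cvgr_norm_le _ wl _ lr.
apply: (@normal_cvg_ratio _ _ _ ((1 + `|l|) / 2) 1 M).
  by have := normr_ge0 l; lra.
move=> n /MP/= wn; rewrite addn1 uS (le_trans (ler_normM _ _))// mulrC.
exact: ler_wpM2r.
Qed.

End SeriesInBanachAlgebra.

Section BilateralSum.
Context (K : realType) (R : banachAlgType K) (Q C D : R).
Hypothesis Q_to0 : (Q ^+ n) @[n --> \oo] --> (0 : R).
Hypotheses (QC : GRing.comm Q C) (QD : GRing.comm Q D).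
Hypotheses (uD : D \is a GRing.unit) (normC : `|C| < 1).
Hypothesis uC : forall n, 1 - C * Q ^+ n \is a GRing.unit.
Hypothesis uCD : forall n, C * Q ^+ n.+1 - D \is a GRing.unit.

Definition psi_pos (b : R) (k : nat) : R :=
  \prod_(i < k) ((C - D * Q ^+ i) * (1 - b * Q ^+ i)^-1).

(* The [i]-th factor is the inverse of the factor of [psi_pos] of index [- i.+1],
   with numerator and denominator multiplied by [Q ^+ i.+1]. *)
Definition psi_neg (b : R) (n : nat) : R :=
  \prod_(i < n) ((Q ^+ i.+1 - b) * (C * Q ^+ i.+1 - D)^-1).

Definition psi_sum (b : R) : R :=
  limn (series (psi_pos b)) + limn (series (fun n => psi_neg b n.+1)).

Definition commutes_with_all (b : R) : Prop :=
  [/\ GRing.comm b Q, GRing.comm b C & GRing.comm b D].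

Definition admissible (b : R) : Prop :=
  commutes_with_all b /\ forall n, 1 - b * Q ^+ n \is a GRing.unit.

Lemma psi_posS b k : psi_pos b k.+1 = psi_pos b k * ((C - D * Q ^+ k) * (1 - b * Q ^+ k)^-1).
Proof. by rewrite /psi_pos big_ord_recr. Qed.

Lemma psi_negS b n :
  psi_neg b n.+1 = psi_neg b n * ((Q ^+ n.+1 - b) * (C * Q ^+ n.+1 - D)^-1).
Proof. by rewrite /psi_neg big_ord_recr. Qed.

Lemma psi_pos0 b : psi_pos b 0 = 1. Proof. by rewrite /psi_pos big_ord0. Qed.

Lemma psi_neg0 b : psi_neg b 0 = 1. Proof. by rewrite /psi_neg big_ord0. Qed.

Lemma commutes_with_all1 : commutes_with_all 1.
Proof. by split; apply/commr_sym/commr1. Qed.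

Lemma commutes_with_allB a b :
  commutes_with_all a -> commutes_with_all b -> commutes_with_all (a - b).
Proof.
by move=> [aQ aC aD] [bQ bC bD]; split; apply/commr_sym/commrB; exact: commr_sym.
Qed.

Lemma commutes_with_allM a b :
  commutes_with_all a -> commutes_with_all b -> commutes_with_all (a * b).
Proof.
by move=> [aQ aC aD] [bQ bC bD]; split; apply/commr_sym/commrM; exact: commr_sym.
Qed.

Lemma commutes_with_allX n : commutes_with_all (Q ^+ n).
Proof. by split; apply/commr_sym/commrX => //; exact: commr_sym. Qed.

Lemma commutes_with_all_pos b i : commutes_with_all b -> GRing.comm b (C - D * Q ^+ i).
Proof. by case=> bQ bC bD; apply: commrB => //; apply: commrM => //; exact: commrX. Qed.

Lemma commutes_with_all_neg b i : commutes_with_all b -> GRing.comm b (C * Q ^+ i - D).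
Proof. by case=> bQ bC bD; apply: commrB => //; apply: commrM => //; exact: commrX. Qed.

Lemma commutes_with_all_1sub b i : commutes_with_all b -> commutes_with_all (1 - b * Q ^+ i).
Proof.
move=> cb; apply: commutes_with_allB; first exact: commutes_with_all1.
by apply: commutes_with_allM => //; exact: commutes_with_allX.
Qed.

Lemma admissible_shift b N : admissible b -> admissible (b * Q ^+ N).
Proof.
move=> [cb ub]; split; last by move=> n; rewrite -mulrA -exprD.
by apply: commutes_with_allM => //; exact: commutes_with_allX.
Qed.

Lemma admissibleQ : admissible Q.
Proof. by split=> [|n]; [split|rewrite -exprS; exact: unit_1sub_expr]. Qed.

(** Denominators telescope as (b;Q)_(k+1) = (1 - b) (bQ;Q)_k. The factor 1 - b commutes with all the
    others, so each numerator keeps its place; the last one is left without a denominator. *)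
Lemma psi_pos_shift b k : admissible b ->
  psi_pos b k.+1 * (1 - b) = psi_pos (b * Q) k * (C - D * Q ^+ k).
Proof.
move=> [cb ub].
have c0 : commutes_with_all (1 - b) by have := commutes_with_all_1sub 0 cb; rewrite expr0 mulr1.
have cV i : GRing.comm (1 - b) (1 - b * Q ^+ i)^-1.
  apply/commrV/commrB; first exact: commr1.
  apply: commrM; last by apply/commrX; case: c0.
  by apply/commr_sym/commrB => //; exact: commr1.
elim: k => [|k IH].
  by rewrite psi_posS !psi_pos0 !mul1r expr0 !mulr1 divrK// -[b]mulr1 (ub 0%N).
rewrite psi_posS -mulrA.
have -> : (C - D * Q ^+ k.+1) * (1 - b * Q ^+ k.+1)^-1 * (1 - b) =
    (1 - b) * ((C - D * Q ^+ k.+1) * (1 - b * Q ^+ k.+1)^-1).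
  by rewrite -mulrA -cV !mulrA (commutes_with_all_pos _ c0).
rewrite mulrA IH psi_posS -[b * Q * _]mulrA -exprS -!mulrA; congr (_ * (_ * _)).
by apply/commrV/commr_sym/commutes_with_all_pos/commutes_with_all_1sub.
Qed.

Lemma psi_pos_scale b k : admissible b ->
  psi_pos b k * (1 - b) = psi_pos (b * Q) k * (1 - b * Q ^+ k).
Proof.
move=> ab; case: (k) => [|j]; first by rewrite !psi_pos0 expr0 mulr1.
rewrite psi_pos_shift// psi_posS -!mulrA -exprS mulVr ?mulr1//.
by case: ab.
Qed.

(** Since Q^(i+1) - b Q = (Q^i - b) Q, replacing b by b Q shifts the numerators by one index, which
    creates the new first factor 1 - b, and each of the n + 1 factors contributes one [Q]. *)
Lemma psi_neg_shift b n : commutes_with_all b ->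
  psi_neg (b * Q) n.+1 =
  psi_neg b n * (1 - b) * (Q ^+ n.+1 * (C * Q ^+ n.+1 - D)^-1).
Proof.
move=> cb; have cQ := commutes_with_allX 1; rewrite expr1 in cQ.
have c0 : commutes_with_all (1 - b) by have := commutes_with_all_1sub 0 cb; rewrite expr0 mulr1.
have eQ i : Q ^+ i.+2 - b * Q = (Q ^+ i.+1 - b) * Q by rewrite mulrBl -exprSr.
elim: n => [|n IH].
  by rewrite psi_negS !psi_neg0 !mul1r !expr1 mulrA -[X in X - _ * _]mul1r -mulrBl.
have cQb : commutes_with_all (Q ^+ n.+1 - b).
  by apply: commutes_with_allB => //; exact: commutes_with_allX.
have c0b : GRing.comm (Q ^+ n.+1 - b) (1 - b).
  apply: commrB; first exact: commr1.
  by apply/commr_sym/commrB => //; apply/commrX; case: cb.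
rewrite psi_negS IH eQ psi_negS -!(mulrA (psi_neg b n)); congr (_ * _).
rewrite [Q ^+ n.+2]exprSr.
set q := Q ^+ n.+1; set Y := (C * q - D)^-1; set Y' := (_ - D)^-1.
have cY b' : commutes_with_all b' -> Y * b' = b' * Y.
  by move=> cb'; apply/esym/commrV/commutes_with_all_neg.
have cqb : q * (q - b) = (q - b) * q by apply/esym/commrX; case: cQb.
transitivity ((1 - b) * q * (q - b) * (Y * (Q * Y'))).
  by rewrite !mulrA -(mulrA _ Y (q - b)) cY// !mulrA.
rewrite -(mulrA q Q) -(mulrA (q - b) Y (1 - b)) (cY _ c0) (mulrA (q - b)).
rewrite -(mulrA _ Y) (mulrA Y q) (cY q); last exact: commutes_with_allX.
rewrite -(mulrA q Y) (mulrA (_ * (1 - b)) q); congr (_ * _).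
by rewrite c0b -!mulrA cqb.
Qed.

(** Expressed through the term of b Q, the bracket becomes (1 - b Q^k) D - (C - D Q^k) b, in which
    the terms with Q^k cancel. *)
Lemma psi_pos_contiguous b k : admissible b ->
  (psi_pos b k * D - psi_pos b k.+1 * b) * (1 - b) = psi_pos (b * Q) k * (D - b * C).
Proof.
move=> ab; have [cb ub] := ab; have [bQ bC bD] := cb.
have c0 : commutes_with_all (1 - b) by have := commutes_with_all_1sub 0 cb; rewrite expr0 mulr1.
have [_ _ c0D] := c0; have c0b : GRing.comm b (1 - b) by apply: commrB => //; exact: commr1.
rewrite mulrBl -!mulrA -c0D c0b !mulrA psi_pos_scale// psi_pos_shift// -!mulrA -mulrBr.
have qD : Q ^+ k * D = D * Q ^+ k by apply/esym/commrX/commr_sym.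
congr (_ * _); rewrite mulrBl mul1r -(commutes_with_all_pos k cb) mulrBr.
by rewrite -(mulrA b) qD opprB addrA subrK.
Qed.

(** This is the relation of [psi_pos_contiguous] at index -(n+1), whose successor is -n. With the
    case of nonnegative indices it covers every integer exactly once. *)
Lemma psi_neg_contiguous b n : commutes_with_all b ->
  (psi_neg b n.+1 * D - psi_neg b n * b) * (1 - b) =
  psi_neg (b * Q) n.+1 * (D - b * C).
Proof.
move=> cb; have [bQ bC bD] := cb.
have c0 : commutes_with_all (1 - b) by have := commutes_with_all_1sub 0 cb; rewrite expr0 mulr1.
rewrite psi_neg_shift// psi_negS; set q := Q ^+ n.+1; set Y := (C * q - D)^-1.
have YD : Y * D = Y * (C * q) - 1.
  by apply/eqP; rewrite eq_sym subr_eq addrC -subr_eq -mulrBr mulVr//; exact: uCD.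
have [_ qC qD] := commutes_with_allX n.+1.
have bY : b * Y = Y * b by apply/commrV/commutes_with_all_neg.
have qY : q * Y = Y * q by apply/commrV/commutes_with_all_neg/commutes_with_allX.
have key : (q - b) * Y * D - b = q * Y * (D - b * C).
  have e : q * Y * (b * C) = b * (Y * (C * q)).
    have qb : q * b = b * q by apply/esym/commrX.
    by rewrite (mulrA b Y) bY qY -!mulrA; congr (_ * _); rewrite mulrA qb -mulrA qC.
  rewrite mulrBr e !mulrBl -[b * Y * D]mulrA YD mulrBr mulr1 opprB addrA.
  by rewrite addrAC addrK.
have c0k : GRing.comm (1 - b) (q * Y * (D - b * C)).
  have [c0Q c0C c0D] := c0; apply: commrM; last first.
    apply: commrB => //; apply: commrM => //.
    by apply/commr_sym/commrB => //; exact: commr1.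
  apply: commrM; first exact: commrX.
  exact/commrV/commutes_with_all_neg.
rewrite -!(mulrA (psi_neg b n)) -mulrBr key -(mulrA (psi_neg b n)).
by congr (_ * _); rewrite -c0k !mulrA.
Qed.

Lemma normal_cvg_psi_pos b : admissible b -> cvgn (series (fun k => `|psi_pos b k|)).
Proof.
move=> [_ ub]; apply: (normal_cvg_factor _ normC (psi_posS b)).
rewrite -[X in _ --> X]mulr1; apply: banach_cvgM; last exact: cvg_V1subMexpr.
rewrite -[X in _ --> X]subr0 -(mulr0 D).
by apply: cvgB; [exact: cvg_cst|exact: banach_cvgMr].
Qed.

Lemma cvg_psi_pos b : admissible b ->
  series (psi_pos b) @ \oo --> limn (series (psi_pos b)).
Proof. by move=> ab; exact/normed_cvg/normal_cvg_psi_pos. Qed.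

Lemma cvg_expr1 : (Q ^+ n.+1) @[n --> \oo] --> (0 : R).
Proof. by rewrite (cvg_shiftS (GRing.exp Q)). Qed.

Lemma cvg_psi_neg_denom : (fun n => (C * Q ^+ n.+1 - D)^-1) @ \oo --> (- D)^-1.
Proof.
apply: banach_cvgV => //; first by rewrite unitrN.
rewrite -[X in _ --> X]add0r -(mulr0 C).
by apply: cvgB; [exact/banach_cvgMr/cvg_expr1|exact: cvg_cst].
Qed.

(** Only the negative half needs a condition, as |C| < 1 settles the positive one. A bound |D^-1 b|
    < 1 would be a poor substitute: it may fail for b = Q, and it need not pass from b to b Q^N. *)
Definition psi_summable b := cvgn (series (fun n => `|psi_neg b n|)).

Lemma psi_summable_norm b : `|D^-1 * b| < 1 -> GRing.comm b D -> psi_summable b.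
Proof.
move=> b1 bD; apply: (normal_cvg_factor _ b1 (psi_negS b)).
have -> : D^-1 * b = (0 - b) * (- D)^-1 by rewrite sub0r invrN mulrNN; exact/esym/commrV.
apply: banach_cvgM; last exact: cvg_psi_neg_denom.
by apply: cvgB; [exact: cvg_expr1|exact: cvg_cst].
Qed.

Lemma psi_summableMQ b : commutes_with_all b -> psi_summable b -> psi_summable (b * Q).
Proof.
move=> cb sb; apply: (@cvgn_series_shift _ K^o _ 1%N).
have [L L0 LP] := banach_bounded
  (@banach_cvgMr _ _ _ _ (1 - b) (banach_cvgM cvg_expr1 cvg_psi_neg_denom)).
apply: (normal_cvg_dominated (L := L) sb) => n.
rewrite addn1 psi_neg_shift// -mulrA mulrC (le_trans (ler_normM _ _))//.
exact: ler_wpM2l.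
Qed.

Lemma psi_summableMexp b N :
  commutes_with_all b -> psi_summable b -> psi_summable (b * Q ^+ N).
Proof.
move=> cb sb; elim: N => [|N IH]; first by rewrite expr0 mulr1.
rewrite exprSr mulrA; apply: psi_summableMQ => //.
by apply: commutes_with_allM => //; exact: commutes_with_allX.
Qed.

Lemma psi_negQ n : psi_neg Q n.+1 = 0.
Proof. by rewrite /psi_neg big_ord_recl /= expr1 subrr !mul0r. Qed.

Lemma psi_summableQ : psi_summable Q.
Proof.
apply: (@normal_cvg_ratio _ _ _ 0 1 0%N); first by rewrite lexx ltr01.
by move=> n _; rewrite addn1 psi_negQ normr0 mul0r.
Qed.

Lemma cvg_psi_neg b : psi_summable b ->
  series (fun n => psi_neg b n.+1) @ \oo --> limn (series (fun n => psi_neg b n.+1)).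
Proof.
move=> sb; have /cvg_ex[l /cvg_seriesS cl] : cvgn (series (psi_neg b)) by exact/normed_cvg.
exact: cvgP cl.
Qed.

Lemma psi_sum_contiguous b : admissible b -> psi_summable b ->
  psi_sum b * (D - b) * (1 - b) = psi_sum (b * Q) * (D - b * C).
Proof.
move=> ab sb; have [cb _] := ab.
have abQ : admissible (b * Q) by have := admissible_shift 1 ab; rewrite expr1.
have cP := cvg_psi_pos ab; have cN := cvg_psi_neg sb.
have eP := @cvg_seriesMl _ _ _ _ (1 - b)
  (cvg_seriesB (@cvg_seriesMl _ _ _ _ D cP) (@cvg_seriesMl _ _ _ _ b (cvg_seriesS cP))).
have eN := @cvg_seriesMl _ _ _ _ (1 - b)
  (cvg_seriesB (@cvg_seriesMl _ _ _ _ D cN) (@cvg_seriesMl _ _ _ _ b (cvg_seriesSV cN))).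
(* Shifting the index moves the term 1 at index 0 from the positive half to the negative one; the -1
   here and the +1 in [eN] cancel in the total. *)
have {}eP : (limn (series (psi_pos b)) * D - (limn (series (psi_pos b)) - 1) * b) * (1 - b) =
    limn (series (psi_pos (b * Q))) * (D - b * C).
  rewrite -[X in (_ - X) * b](psi_pos0 b); apply: cvg_unique eP _ => //=.
  have := @cvg_seriesMl _ _ _ _ (D - b * C) (cvg_psi_pos abQ).
  by under eq_fun do rewrite -psi_pos_contiguous//.
have {}eN : (limn (series (fun n => psi_neg b n.+1)) * D -
      (1 + limn (series (fun n => psi_neg b n.+1))) * b) * (1 - b) =
    limn (series (fun n => psi_neg (b * Q) n.+1)) * (D - b * C).
  rewrite -[X in (X + _) * b](psi_neg0 b); apply: cvg_unique eN _ => //=.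
  have := @cvg_seriesMl _ _ _ _ (D - b * C) (cvg_psi_neg (psi_summableMQ cb sb)).
  by under eq_fun do rewrite -psi_neg_contiguous//.
rewrite /psi_sum [in RHS]mulrDl -eP -eN -mulrDl; congr (_ * _).
rewrite mulrBr mulrDl addrACA; congr (_ + _).
rewrite -opprD; congr (- _); rewrite -mulrDl; congr (_ * _).
by rewrite addrA subrK.
Qed.

(** * Passage to b = 0, and the value at b = Q *)

Lemma cvg_psi_posMexp b k : admissible b -> psi_pos (b * Q ^+ N) k @[N --> \oo] --> psi_pos 0 k.
Proof.
move=> [_ ub]; elim: k => [|k IH].
  by under eq_fun do rewrite psi_pos0; rewrite psi_pos0; exact: cvg_cst.
under eq_fun do rewrite psi_posS; rewrite psi_posS; apply: banach_cvgM => //.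
apply: banach_cvgMr; rewrite mul0r subr0 invr1.
under eq_fun do rewrite -mulrA -exprD.
have := cvg_V1subMexpr Q_to0 ub.
by rewrite -(@cvg_shiftn k).
Qed.

Lemma cvg_psi_negMexp b n : psi_neg (b * Q ^+ N) n @[N --> \oo] --> psi_neg 0 n.
Proof.
elim: n => [|n IH].
  by under eq_fun do rewrite psi_neg0; rewrite psi_neg0; exact: cvg_cst.
under eq_fun do rewrite psi_negS; rewrite psi_negS; apply: banach_cvgM => //.
apply: banach_cvgMl; apply: cvgB; first exact: cvg_cst.
by rewrite -(mulr0 b); exact: banach_cvgMr.
Qed.

Lemma cvg_psi_sumMexp b : admissible b -> psi_sum (b * Q ^+ N) @[N --> \oo] --> psi_sum 0.
Proof.
move=> ab; have [_ ub] := ab; have C1 := normC; apply: cvgD.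
(* With |C - D Q^k| <= (1 + |C|)/2 <= 1 and the inverse within (1 - |C|)/4 of 1, the ratio is at
   most (3 + |C|)/4 < 1. The inverse is taken at exponent N + k, so a large k suffices for all
   [N]. *)
- have c1 : `|C| < (1 + `|C|) / 2 by lra.
  have cX : (fun k => C - D * Q ^+ k) @ \oo --> C.
    rewrite -[X in _ --> X]subr0 -(mulr0 D).
    by apply: cvgB; [exact: cvg_cst|exact: banach_cvgMr].
  have [M1 _ M1P] := cvgr_norm_le _ cX _ c1.
  have d0 : 0 < (1 - `|C|) / 4 by lra.
  have /cvgrPdist_le/(_ _ d0)[M2 _ M2P] := cvg_V1subMexpr Q_to0 ub.
  apply: (@tannery_ratio _ _ _ _ ((3 + `|C|) / 4) (maxn M1 M2) 0%N).
  + by have := normr_ge0 C; lra.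
  + move=> N k _; rewrite geq_max => /andP[k1 k2].
    rewrite psi_posS (le_trans (ler_normM _ _))// mulrC ler_wpM2r//.
    have := M1P k k1; have := M2P (N + k)%N (leq_trans k2 (leq_addl _ _)) => /=.
    rewrite distrC -mulrA -exprD; set V := (_)^-1; set X := C - _ => hV hX.
    have -> : X * V = X + X * (V - 1) by rewrite mulrBr mulr1 addrC subrK.
    have h1 := ler_normD X (X * (V - 1)); have h2 := ler_normM X (V - 1).
    have h3 : `|X| * `|V - 1| <= `|V - 1| by rewrite ler_piMl//; lra.
    lra.
  + by move=> k; exact: cvg_psi_posMexp.
- have [L L0 LP] := banach_bounded cvg_psi_neg_denom.
  (* Both terms of the numerator Q^(k+2) - b Q^N are at most this constant, so the ratio is at most
     L / (2 (L + 1)) <= 1/2; L + 1 avoids dividing by 0. *)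
  have d0 : 0 < (4 * (L + 1))^-1 by rewrite invr_gt0; lra.
  have /cvgr0Pnorm_le/(_ _ d0)[M _ MP] := cvg_expr1.
  have /cvgr0Pnorm_le/(_ _ d0)[N0 _ NP] : (b * Q ^+ N) @[N --> \oo] --> (0 : R).
    by rewrite -(mulr0 b); exact: banach_cvgMr.
  apply: (@tannery_ratio _ _ _ _ 2^-1 M N0).
  + by lra.
  + move=> N k N0N Mk; rewrite psi_negS (le_trans (ler_normM _ _))// mulrC ler_wpM2r//.
    rewrite (le_trans (ler_normM _ _))//.
    have hQ := MP k.+1 (leqW Mk); have hb := NP N N0N; rewrite /= in hQ hb.
    rewrite (@le_trans _ _ ((4 * (L + 1))^-1 * 2 * L))//.
      apply: ler_pM => //.
      by rewrite (le_trans (ler_normB _ _))// mulr_natr mulr2n lerD// MP //= leqW.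
    rewrite -mulrA mulrC ler_pdivrMr; last by lra.
    lra.
  + by move=> k; exact: cvg_psi_negMexp.
Qed.

Lemma psi_sum_step b : admissible b -> psi_summable b ->
  psi_sum b * (1 - D^-1 * b) * (1 - b) = psi_sum (b * Q) * (1 - C * D^-1 * b).
Proof.
move=> ab sb; have [cb _] := ab; have [bQ bC bD] := cb; apply: (mulIr uD).
have c0 : GRing.comm (1 - b) D.
  by apply/commr_sym/commrB; [exact: commr1|exact: commr_sym].
rewrite -[LHS]mulrA c0 mulrA -(mulrA (psi_sum b)) -[RHS]mulrA.
rewrite [(1 - D^-1 * b) * D]mulrBl [(1 - C * D^-1 * b) * D]mulrBl !mul1r.
have e1 : D^-1 * b * D = b by rewrite -mulrA bD mulKr.
have e2 : C * D^-1 * b * D = b * C by rewrite -(mulrA C) -(mulrA C) e1 bC.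
rewrite e1 e2.
exact: psi_sum_contiguous.
Qed.

(* The [q]-binomial theorem: the functional equation in [C] and [D] shifts
   both parameters by [Q], which multiplies the [k]-th term by [Q ^+ k]. *)
Lemma psi_sumQ (p : nat -> R) : p 0%N = 1 ->
  (forall n, p n.+1 = (1 - D * Q ^+ n) * (1 - C * Q ^+ n)^-1 * p n) ->
  psi_sum Q = limn p.
Proof.
move=> p0 pS; set g := psi_pos Q; set t := fun N k => g k * Q ^+ (N * k).
have ng : cvgn (series (fun k => `|g k|)) := normal_cvg_psi_pos admissibleQ.
have [L L0 LP] := banach_bounded Q_to0.
have ct N : series (t N) @ \oo --> limn (series (t N)).
  apply: normed_cvg; apply: (normal_cvg_dominated (L := L) ng) => k.
  by rewrite mulrC (le_trans (ler_normM _ _))// ler_wpM2l.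
set F := fun N => limn (series (t N)).
have gS k : g k.+1 * (1 - Q ^+ k.+1) = g k * (C - D * Q ^+ k).
  by rewrite /g psi_posS -exprS -!mulrA mulVr ?mulr1//; exact: unit_1sub_expr.
(* The coefficient recurrence [gS], multiplied by Q^(N(k+1)) and summed over k; in the difference of
   the sums for N and N + 1 the terms with k = 0 cancel. *)
have Fstep N : F N * (1 - C * Q ^+ N) = F N.+1 * (1 - D * Q ^+ N).
  have d1 := cvg_seriesS (cvg_seriesB (ct N) (ct N.+1)).
  have d2 := cvg_seriesB (@cvg_seriesMl _ _ _ _ (C * Q ^+ N) (ct N))
    (@cvg_seriesMl _ _ _ _ (D * Q ^+ N) (ct N.+1)).
  have E : (fun k => t N k.+1 - t N.+1 k.+1) =
      (fun k => t N k * (C * Q ^+ N) - t N.+1 k * (D * Q ^+ N)).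
    apply/funext => k; rewrite /t.
    have cC n : Q ^+ n * C = C * Q ^+ n by apply/esym/commrX/commr_sym.
    have cD n : Q ^+ n * D = D * Q ^+ n by apply/esym/commrX/commr_sym.
    have eC : Q ^+ (N * k) * (C * Q ^+ N) = C * Q ^+ (N + N * k).
      by rewrite mulrA cC -mulrA -exprD addnC.
    have eD : Q ^+ (k + N * k) * (D * Q ^+ N) = D * Q ^+ (k + (N + N * k)).
      by rewrite mulrA cD -mulrA -exprD -addnA (addnC _ N).
    rewrite !mulSn -!mulrA eC eD -!mulrBr exprD -[X in X - _]mul1r -mulrBl.
    by rewrite mulrA gS -mulrA mulnS exprD mulrBl -!mulrA -!exprD.
  have e0 : t N 0%N - t N.+1 0%N = 0 by rewrite /t !muln0 subrr.
  have : F N - F N.+1 - 0 = F N * (C * Q ^+ N) - F N.+1 * (D * Q ^+ N).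
    by rewrite -[X in _ - X = _]e0; apply: cvg_unique d1 _ => //; rewrite E; exact: d2.
  rewrite subr0 !mulrBr !mulr1 => h; apply/eqP; rewrite -subr_eq0 opprD opprK addrACA h.
  by rewrite addrACA subrr addNr addr0.
have F0 N : F 0%N = F N * p N.
  elim: N => [|N ->]; first by rewrite p0 mulr1.
  by rewrite pS mulrA; congr (_ * _); rewrite mulrA -Fstep mulrK.
(* Only the constant term survives as [N] grows, so F N tends to 1 and F 0 = F N p N becomes F 0 =
   limn p. *)
have F1 : F N @[N --> \oo] --> limn (series (fun k => (k == 0%N)%:R : R)).
  have cw : (fun k => (C - D * Q ^+ k) * (1 - Q * Q ^+ k)^-1) @ \oo --> C * 1.
    apply: banach_cvgM; last by apply: cvg_V1subMexpr => //; case: admissibleQ.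
    rewrite -[X in _ --> X]subr0 -(mulr0 D).
    by apply: cvgB; [exact: cvg_cst|exact: banach_cvgMr].
  have [L' L'0 L'P] := banach_bounded cw.
  have d0 : 0 < (2 * (L' + 1))^-1 by rewrite invr_gt0; lra.
  have /cvgr0Pnorm_le/(_ _ d0)[N0 _ NP] := Q_to0.
  apply: (@tannery_ratio _ _ _ _ 2^-1 0%N N0); first by lra.
  - move=> N k N0N _; set w := (C - D * Q ^+ k) * (1 - Q * Q ^+ k)^-1.
    have cw' : GRing.comm (Q ^+ (N * k)) w.
      apply: commrM; first exact/commutes_with_all_pos/commutes_with_allX.
      apply/commrV/commrB; first exact: commr1.
      by rewrite -exprS; apply: commrX; apply/commr_sym/commrX.
    have -> : t N k.+1 = t N k * (w * Q ^+ N).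
      rewrite /t /g psi_posS mulnS addnC exprD -/w.
      rewrite -!(mulrA (psi_pos Q k)); congr (_ * _).
      by rewrite (mulrA w) -cw' -(mulrA _ w).
    rewrite (le_trans (ler_normM _ _))// mulrC ler_wpM2r//.
    rewrite (le_trans (ler_normM _ _))//.
    have hw : `|w| <= L' := L'P k; have hN : `|Q ^+ N| <= (2 * (L' + 1))^-1 := NP N N0N.
    rewrite (@le_trans _ _ (L' * (2 * (L' + 1))^-1))//; first exact: ler_pM.
    by rewrite ler_pdivrMr; lra.
  - case=> [|k].
      by rewrite /t; under eq_fun do rewrite muln0 /g psi_pos0 mulr1; exact: cvg_cst.
    rewrite /t [X in _ --> X](_ : _ = g k.+1 * 0); last by rewrite mulr0.
    apply: banach_cvgMr.
    have h : (fun N => L * `|Q ^+ N|) @ \oo --> (0 : K).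
      by rewrite -(mulr0 L) -(normr0 R); apply: cvgMr; exact: cvg_norm.
    apply: cvg_dist_squeeze h; apply: nearW => N.
    by rewrite subr0 mulnS addnC exprD (le_trans (ler_normM _ _))// ler_wpM2r.
have e1 : limn (series (fun k => (k == 0%N)%:R : R)) = 1.
  apply/cvg_lim => //; rewrite -(cvg_shiftS (series _)).
  rewrite [X in X @ _](_ : _ = cst 1) ?cvg_cst//; first exact: cvg_cst.
  by apply/funext => n /=; rewrite /series /= big_nat_recl// big1 ?addr0.
have cp : p @ \oo --> limn p by exact: (cvgn_qprod_l Q_to0 uC pS).
have := banach_cvgM F1 cp; rewrite e1 mul1r; under eq_fun do rewrite -F0.
move=> /(cvg_unique _ (cvg_cst (F 0%N))) <- //.
rewrite /psi_sum /F.
have -> : series (t 0%N) = series g.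
  by apply/funext => n; rewrite /series /=; under eq_bigr do rewrite /t mul0n expr0 mulr1.
have -> : series (fun n => psi_neg Q n.+1) = cst 0.
  by apply/funext => n; rewrite /series /= big1// => i _; exact: psi_negQ.
by rewrite lim_cst// addr0.
Qed.

(** The four products are given by recurrences and not by formulas, so that the same statement can
    be read in the opposite algebra, where factors and inverses appear in reversed order. *)
Theorem psi_sum_eval (B : R) (p1 p2 p3 e : nat -> R) :
  admissible B -> `|D^-1 * B| < 1 ->
  (forall n, 1 - D^-1 * B * Q ^+ n \is a GRing.unit) ->
  p1 0%N = 1 -> (forall n, p1 n.+1 = (1 - D * Q ^+ n) * (1 - C * Q ^+ n)^-1 * p1 n) ->
  p2 0%N = 1 -> (forall n, p2 n.+1 =
    p2 n * ((1 - D^-1 * Q * Q ^+ n) * (1 - C * D^-1 * Q * Q ^+ n)^-1)) ->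
  p3 0%N = 1 -> (forall n, p3 n.+1 =
    (1 - C * D^-1 * B * Q ^+ n) * (1 - D^-1 * B * Q ^+ n)^-1 * p3 n) ->
  e 0%N = 1 -> (forall n, e n.+1 = e n * ((1 - Q * Q ^+ n) * (1 - B * Q ^+ n)^-1)) ->
  [/\ cvgn p1, cvgn p2, cvgn p3, cvgn e &
    psi_sum B = limn p1 * limn p2 * limn p3 * limn e].
Proof.
move=> aB B1 uDB p10 p1S p20 p2S p30 p3S e0 eS.
have [cB uB] := aB; have [BQ BC BD] := cB.
have [_ uQ] := admissibleQ.
have uCDQ n : 1 - C * D^-1 * Q * Q ^+ n \is a GRing.unit.
  have -> : 1 - C * D^-1 * Q * Q ^+ n = - (C * Q ^+ n.+1 - D) * D^-1.
    have [_ _ qD] := commutes_with_allX n.+1.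
    rewrite opprB mulrBl mulrV// -!mulrA -exprS; congr (_ - _ * _).
    exact/esym/commrV.
  by rewrite unitrMl ?unitrV// unitrN.
have c1 : cvgn p1 := cvgn_qprod_l Q_to0 uC p1S.
have c2 : cvgn p2 := cvgn_qprod_r Q_to0 uCDQ p2S.
have c3 : cvgn p3 := cvgn_qprod_l Q_to0 uDB p3S.
have ce : cvgn e := cvgn_qprod_r Q_to0 uB eS.
split => //.
(* 1 / (Q;Q)_N. It cancels the numerator of [e], which contains (Q;Q)_N, and it is exactly the
   product of the factors 1 / (1 - b) collected when iterating from b = Q. *)
set h := fun N => \prod_(i < N) (1 - Q * Q ^+ i)^-1.
have h0 : h 0%N = 1 by rewrite /h big_ord0.
have hS n : h n.+1 = h n * (1 - Q * Q ^+ n)^-1 by rewrite /h big_ord_recr.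
have ch : cvgn h.
  by apply: (cvgn_qprod_r (a := 0) Q_to0 uQ) => n; rewrite hS mul0r subr0 mul1r.
have comm1Q x n : GRing.comm x Q -> GRing.comm x (1 - Q * Q ^+ n).
  move=> xQ; apply: commrB; first exact: commr1.
  by apply: commrM => //; exact: commrX.
have comm1B x n : GRing.comm x Q -> GRing.comm x B -> GRing.comm x (1 - B * Q ^+ n).
  move=> xQ xB; apply: commrB; first exact: commr1.
  by apply: commrM => //; exact: commrX.
have comm_h x n : GRing.comm x Q -> GRing.comm x (h n).
  by move=> xQ; apply: commr_prod => i _; exact/commrV/comm1Q.
have QB : GRing.comm Q B by exact: commr_sym.
have QDV : GRing.comm Q D^-1 by exact: commrV.
have BDV : GRing.comm B D^-1 by exact: commrV.
have commw x n : GRing.comm x Q -> GRing.comm x B -> GRing.comm x C -> GRing.comm x D ->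
    GRing.comm x ((1 - C * D^-1 * B * Q ^+ n) * (1 - D^-1 * B * Q ^+ n)^-1).
  move=> xQ xB xC xD; have xDV : GRing.comm x D^-1 by exact: commrV.
  by apply: commrM; [|apply: commrV]; (apply: commrB; [exact: commr1|]);
    do 3?[apply: commrM => //]; exact: commrX.
have commp3 x n : GRing.comm x Q -> GRing.comm x B -> GRing.comm x C -> GRing.comm x D ->
    GRing.comm x (p3 n).
  move=> xQ xB xC xD; elim: n => [|n IH]; first by rewrite p30; exact: commr1.
  by rewrite p3S; apply: commrM => //; exact: commw.
have comme x n : GRing.comm x Q -> GRing.comm x B -> GRing.comm x (e n).
  move=> xQ xB; elim: n => [|n IH]; first by rewrite e0; exact: commr1.
  rewrite eS; apply: commrM => //; apply: commrM; first exact: comm1Q.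
  exact/commrV/comm1B.
(* Here the relation is solved for the sum at the unshifted argument, which inverts 1 - D^-1 B Q^N
   and 1 - B Q^N. *)
have stepB N : psi_sum B = psi_sum (B * Q ^+ N) * h N * p3 N * e N.
  elim: N => [|N ->]; first by rewrite expr0 !mulr1 h0 p30 e0 !mulr1.
  have ab := admissible_shift N aB; have [cb _] := ab.
  have := psi_sum_step ab (psi_summableMexp cB (psi_summable_norm B1 BD)).
  rewrite -[_ * Q]mulrA -exprSr !(mulrA _ B).
  set S := psi_sum (B * Q ^+ N); set S' := psi_sum _; set w1 := 1 - D^-1 * B * _.
  set v := 1 - B * _; set w2 := 1 - C * _ * _ * _ => SS'.
  rewrite hS p3S eS -/w1 -/w2 -/v; set u := 1 - Q * _.
  have [vQ vC vD] : commutes_with_all v by exact: commutes_with_all_1sub.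
  have vB : GRing.comm v B by exact/commr_sym/comm1B.
  have uu : u \is a GRing.unit by exact: uQ.
  have uv : v \is a GRing.unit by exact: uB.
  have [uQ' uC' uD'] : commutes_with_all u.
    by apply: commutes_with_all_1sub; split.
  have uB' : GRing.comm u B by exact/commr_sym/comm1Q.
  have vw1 : GRing.comm v w1.
    apply: commrB; first exact: commr1.
    by do 2?[apply: commrM => //]; [exact: commrV|exact: commrX].
  have Sw : S' * (w2 * w1^-1) = S * v.
    by rewrite mulrA -SS' -mulrA (commrV vw1) mulrA mulrK//; exact: uDB.
  have hw : GRing.comm (h N * u^-1) (w2 * w1^-1).
    by apply/commr_sym/commrM; [apply: comm_h|apply/commrV/comm1Q]; apply/commr_sym/commw.
  set y := h N * u^-1 * p3 N * (e N * (u * v^-1)).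
  have vy : v * y = y * v.
    have vu : GRing.comm v u by exact: comm1Q.
    apply: commrM; first apply: commrM; first apply: commrM.
    - exact: comm_h.
    - exact: commrV.
    - exact: commp3.
    - by apply: commrM; [exact: comme|apply: commrM => //; exact: commrV].
  have yv : y * v = h N * p3 N * e N.
    have upe : GRing.comm u (p3 N * e N) by apply: commrM; [exact: commp3|exact: comme].
    rewrite /y -!(mulrA (h N)); congr (_ * _).
    rewrite -!mulrA mulVr// mulr1 [p3 N * _]mulrA -upe.
    by rewrite mulKr.
  rewrite [S' * _ * _]mulrA -(mulrA S') hw (mulrA S') Sw.
  transitivity (S * (v * y)); last by rewrite /y !mulrA.
  by rewrite vy yv !mulrA.
(* Here the relation is solved in the other direction, for the shifted argument, so that 1 - C D^-1
   Q^(N+1) is inverted and 1 - D^-1 Q^(N+1) is not. *)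
have stepQ N : psi_sum (Q * Q ^+ N) * h N = psi_sum Q * p2 N.
  elim: N => [|N IH]; first by rewrite expr0 !mulr1 h0 p20.
  have [cQ _] := admissibleQ; have aQ := admissible_shift N admissibleQ.
  have := psi_sum_step aQ (psi_summableMexp cQ psi_summableQ).
  rewrite -[_ * Q]mulrA -exprSr !(mulrA _ Q).
  set S' := psi_sum (Q * Q ^+ N.+1); set w1 := 1 - D^-1 * Q * _.
  set u := 1 - Q * _; set w2 := 1 - C * _ * _ * _ => SS'.
  have uw2 : w2 \is a GRing.unit by exact: uCDQ.
  have ew : S' = psi_sum (Q * Q ^+ N) * w1 * u * w2^-1 by rewrite SS' mulrK.
  rewrite hS p2S -/w1 -/w2 -/u mulrA -IH ew.
  have Qw1 : GRing.comm Q w1.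
    apply: commrB; first exact: commr1.
    by do 2?[apply: commrM => //]; exact: commrX.
  have Qw2 : GRing.comm Q w2.
    apply: commrB; first exact: commr1.
    by do 3?[apply: commrM => //]; exact: commrX.
  have uw : GRing.comm u (w2^-1 * h N).
    by apply: commrM; [apply: commrV; apply/commr_sym/comm1Q/commr_sym
      |apply/comm_h/commr_sym/comm1Q].
  have hw : GRing.comm (w1 * w2^-1) (h N).
    by apply: comm_h; apply/commr_sym/commrM => //; exact: commrV.
  have -> : psi_sum (Q * Q ^+ N) * w1 * u * w2^-1 * (h N / u) =
      psi_sum (Q * Q ^+ N) * w1 * (u * (w2^-1 * h N)) * u^-1 by rewrite !mulrA.
  rewrite uw -!(mulrA (psi_sum _)); congr (_ * _).
  by rewrite -hw -!mulrA mulrV ?mulr1//; exact: uQ.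
have cd : (fun N => psi_sum (B * Q ^+ N) - psi_sum (Q * Q ^+ N)) @ \oo --> (0 : R).
  rewrite -(subrr (psi_sum 0)); apply: cvgB; first exact: cvg_psi_sumMexp.
  exact: (cvg_psi_sumMexp admissibleQ).
have l1 := banach_cvgM (banach_cvgM (banach_cvgM cd ch) c3) ce.
have l2 := banach_cvgM (banach_cvgM (@banach_cvgMr _ _ _ _ (psi_sum Q) c2) c3) ce.
(* Subtracting and adding psi_sum (Q Q^N) in [stepB] makes the second summand computable by [stepQ],
   while the first is a null sequence times convergent products. *)
have E : (fun N => psi_sum B) = (fun N =>
    (psi_sum (B * Q ^+ N) - psi_sum (Q * Q ^+ N)) * h N * p3 N * e N +
    psi_sum Q * p2 N * p3 N * e N).
  by apply/funext => N; rewrite -stepQ -!mulrDl subrK -stepB.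
have /(cvg_unique _ (cvg_cst (psi_sum B))) : (fun N : nat => psi_sum B) @ \oo -->
    psi_sum Q * limn p2 * limn p3 * limn e.
  rewrite E [X in _ --> X](_ : _ = 0 * limn h * limn p3 * limn e +
    psi_sum Q * limn p2 * limn p3 * limn e); last by rewrite !mul0r add0r.
  exact: cvgD l1 l2.
by rewrite (psi_sumQ p10 p1S); apply.
Qed.

Theorem bilateral_sum_eval (B : R) (L : int -> R) (p1 p2 p3 e : nat -> R) :
  admissible B -> `|D^-1 * B| < 1 ->
  (forall n, 1 - D^-1 * B * Q ^+ n \is a GRing.unit) ->
  L 0 = 1 ->
  (forall n : nat, L n.+1 = L n * ((C - D * Q ^+ n) * (1 - B * Q ^+ n)^-1)) ->
  (forall n : nat,
    L (- n.+1%:Z) = L (- n%:Z) * ((Q ^+ n.+1 - B) * (C * Q ^+ n.+1 - D)^-1)) ->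
  p1 0%N = 1 -> (forall n, p1 n.+1 = (1 - D * Q ^+ n) * (1 - C * Q ^+ n)^-1 * p1 n) ->
  p2 0%N = 1 -> (forall n, p2 n.+1 =
    p2 n * ((1 - D^-1 * Q * Q ^+ n) * (1 - C * D^-1 * Q * Q ^+ n)^-1)) ->
  p3 0%N = 1 -> (forall n, p3 n.+1 =
    (1 - C * D^-1 * B * Q ^+ n) * (1 - D^-1 * B * Q ^+ n)^-1 * p3 n) ->
  e 0%N = 1 -> (forall n, e n.+1 = e n * ((1 - Q * Q ^+ n) * (1 - B * Q ^+ n)^-1)) ->
  [/\ bilateral_cvg L, [/\ cvgn p1, cvgn p2, cvgn p3 & cvgn e] &
    bilateral_sum L = limn p1 * limn p2 * limn p3 * limn e].
Proof.
move=> aB B1 uDB L0 LS LN p10 p1S p20 p2S p30 p3S e0 eS.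
have [c1 c2 c3 ce eq_sum] := psi_sum_eval aB B1 uDB p10 p1S p20 p2S p30 p3S e0 eS.
have BD : GRing.comm B D by have [[]] := aB.
have Lpos n : L n%:Z = psi_pos B n.
  by elim: n => [|n IH]; rewrite ?psi_pos0// LS IH psi_posS.
have Lneg n : L (- n%:Z) = psi_neg B n.
  by elim: n => [|n IH]; rewrite ?psi_neg0 ?oppr0// LN IH psi_negS.
have eP : (fun n : nat => L n%:Z) = psi_pos B by exact/funext.
have eN : (fun n : nat => L (Negz n)) = (fun n => psi_neg B n.+1).
  by apply/funext => n; rewrite NegzE Lneg.
split=> //; last by rewrite /bilateral_sum eP eN.
rewrite /bilateral_cvg eP eN; split; first exact: cvgP (cvg_psi_pos aB).
exact: cvgP (cvg_psi_neg (psi_summable_norm B1 BD)).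
Qed.

End BilateralSum.

(** * The opposite algebra and the shifted factorials *)

Section ConverseAlgebra.
Context (K : realType) (R : banachAlgType K).

Fact converse_normM (x y : R) : `|y * x| <= `|x| * `|y|.
Proof. by rewrite mulrC ler_normM. Qed.

(** The underlying normed space is literally the same, so series, limits and norms are shared by
    conversion and only products, inverses and powers have to be translated. *)
Definition converse_banach : banachAlgType K :=
  @BanachAlg K (banach_space R) (1 : R) (fun x y : R => y * x)
    (fun x y z : R => esym (mulrA z y x)) (@mulr1 R) (@mul1r R)
    (fun x y z : R => mulrDr z x y) (fun x y z : R => mulrDl y z x)
    (oner_neq0 R) (fun a (x y : R) => scalerAr a y x) (fun a (x y : R) => scalerAl a y x)
    converse_normM.

Local Notation Rc := converse_banach.

Lemma converse_mulE (x y : Rc) : x * y = (y : R) * (x : R).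
Proof. by []. Qed.

Lemma converse_unitE (x : Rc) : (x \is a GRing.unit) = ((x : R) \is a GRing.unit).
Proof.
by apply/unitrP/unitrP => -[y [yx xy]]; exists y; split.
Qed.

Lemma converse_invE (x : Rc) : x^-1 = (x : R)^-1.
Proof.
have [xu|xNu] := boolP ((x : R) \is a GRing.unit); last first.
  by rewrite invr_out ?converse_unitE//; exact/esym/(invr_out xNu).
apply: (mulrI xu); apply: etrans (esym (mulrV xu)).
by apply: (mulVr (_ : x \is a GRing.unit)); rewrite converse_unitE.
Qed.

Lemma converse_expE (x : Rc) n : x ^+ n = (x : R) ^+ n.
Proof. by elim: n => [//|n IH]; rewrite exprS exprSr converse_mulE IH. Qed.

End ConverseAlgebra.

(** * Commutation and recurrences of the shifted factorials *)

Section ShiftedFactorialRecurrences.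
Context (R : unitRingType) (r : nat).
Implicit Types (A B : r.-tuple R) (Q Z : R).

Lemma oprod_pos (X : int -> R) (n : nat) :
  oprod X 1 n = \prod_(0 <= i < n) X (1 + i%:Z).
Proof. by rewrite /oprod subrr le0z_nat addrK. Qed.

Lemma oprod_neg (X : int -> R) (n : nat) :
  oprod X 1 (- n%:Z) = \prod_(0 <= i < n) (X (- i%:Z))^-1.
Proof.
case: n => [|n]; first by rewrite oppr0 (oprod_pos _ 0) !big_geq.
by rewrite /oprod subrr; apply: eq_bigr => i _; rewrite sub0r.
Qed.

Lemma comm_oprod (x : R) (X : int -> R) l m :
  (forall j, GRing.comm x (X j)) -> GRing.comm x (oprod X l m).
Proof.
by move=> xX; rewrite /oprod; case: ifP => _; apply: commr_prod => i _ //; exact: commrV.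
Qed.

Lemma comm_1subMexpz (x a Q : R) k :
  GRing.comm x a -> GRing.comm x Q -> GRing.comm x (1 - a * Q ^ k).
Proof.
move=> xa xQ; apply: commrB; first exact: commr1.
by apply: commrM => //; exact: commrXz.
Qed.

Section Commutation.
Context (x : R) (A B : r.-tuple R) (Q Z : R).
Hypotheses (xA : forall i, GRing.comm x (tnth A i)) (xB : forall i, GRing.comm x (tnth B i)).
Hypotheses (xQ : GRing.comm x Q) (xZ : GRing.comm x Z).

Lemma comm_qfact_II k : GRing.comm x (qfact_II A B Q Z k).
Proof.
apply: comm_oprod => j; apply: commrM => //; apply: commr_prod => i _.
by apply: commrM; [apply: commrV|]; exact: comm_1subMexpz.
Qed.

Lemma comm_qfact_revI k : GRing.comm x (qfact_revI A B Q Z k).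
Proof.
apply: comm_oprod => j; apply: commrM => //; apply: commr_prod => i _.
by apply: commrM; [|apply: commrV]; exact: comm_1subMexpz.
Qed.

Lemma comm_qfact_revII k : GRing.comm x (qfact_revII A B Q Z k).
Proof.
apply: comm_oprod => j; apply: commrM => //; apply: commr_prod => i _.
by apply: commrM; [|apply: commrV]; exact: comm_1subMexpz.
Qed.

End Commutation.

Lemma qfact_II0 A B Q Z : qfact_II A B Q Z 0 = 1.
Proof. by rewrite /qfact_II (oprod_pos _ 0) big_geq. Qed.

Lemma qfact_revI0 A B Q Z : qfact_revI A B Q Z 0 = 1.
Proof. by rewrite /qfact_revI (oprod_pos _ 0) big_geq. Qed.

Lemma qfact_revII0 A B Q Z : qfact_revII A B Q Z 0 = 1.
Proof. by rewrite /qfact_revII (oprod_pos _ 0) big_geq. Qed.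

Lemma qfact_IIS A B Q Z (n : nat) :
  qfact_II A B Q Z n.+1 = qfact_II A B Q Z n *
    ((\prod_(i < r) ((1 - tnth B i * Q ^+ n)^-1 * (1 - tnth A i * Q ^+ n))) * Z).
Proof.
by rewrite /qfact_II !oprod_pos big_nat_recr//= [1 + _ - 1]addrAC subrr add0r.
Qed.

Lemma qfact_revIS A B Q Z (n : nat) :
  qfact_revI A B Q Z n.+1 = qfact_revI A B Q Z n *
    (Z * \prod_(i < r) ((1 - tnth A i * Q ^+ n) * (1 - tnth B i * Q ^+ n)^-1)).
Proof.
by rewrite /qfact_revI !oprod_pos big_nat_recr//= [1 + _ - 1]addrAC subrr add0r.
Qed.

Lemma qfact_revIN A B Q Z (n : nat) :
  qfact_revI A B Q Z (- n.+1%:Z) = qfact_revI A B Q Z (- n%:Z) *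
    (Z * \prod_(i < r) ((1 - tnth A i * Q ^- n.+1) * (1 - tnth B i * Q ^- n.+1)^-1))^-1.
Proof.
rewrite /qfact_revI !oprod_neg big_nat_recr//=.
by have -> : - n%:Z - 1 = - n.+1%:Z by rewrite -opprD intS addrC.
Qed.

(** Raising k by one raises each exponent k - j, so the old factors reappear at j + 1 and the new
    one enters on the left, at j = 1. This left growth is what makes type II a type I sum in the
    opposite algebra. *)
Lemma qfact_revIIS A B Q Z (n : nat) :
  qfact_revII A B Q Z n.+1 =
    (Z * \prod_(i < r) ((1 - tnth A i * Q ^+ n) * (1 - tnth B i * Q ^+ n)^-1)) *
    qfact_revII A B Q Z n.
Proof.
rewrite /qfact_revII !oprod_pos big_nat_recl//=; congr (_ * _).
by have -> : n.+1%:Z - (1 + 0%:Z) = n%:Z by rewrite addr0 intS addrAC subrr add0r.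
Qed.

Lemma qfact_revIIN A B Q Z (n : nat) :
  qfact_revII A B Q Z (- n.+1%:Z) =
    (Z * \prod_(i < r) ((1 - tnth A i * Q ^- n.+1) * (1 - tnth B i * Q ^- n.+1)^-1))^-1 *
    qfact_revII A B Q Z (- n%:Z).
Proof.
rewrite /qfact_revII !oprod_neg big_nat_recl//=; congr (_ * _).
  by rewrite oppr0 subr0.
apply: eq_bigr => i _.
by have -> : - n.+1%:Z - - i.+1%:Z = - n%:Z - - i%:Z
  by rewrite !opprK !intS opprD addrACA addNr add0r.
Qed.

End ShiftedFactorialRecurrences.

(** * The two reversed summations *)

Section Ramanujan.
Context (K : realType) (R : banachAlgType K) (A B Z Q : R).
Hypotheses (QA : GRing.comm Q A) (QB : GRing.comm Q B) (QZ : GRing.comm Q Z).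
Hypotheses (BA : GRing.comm B A) (BZ : GRing.comm B Z).
Hypothesis Q_to0 : (Q ^+ n) @[n --> \oo] --> (0 : R).
Hypotheses (uQ : Q \is a GRing.unit) (uA : A \is a GRing.unit) (uZ : Z \is a GRing.unit).
Hypothesis uBQ : forall m : int, 1 - B * Q ^ m \is a GRing.unit.
Hypothesis uAQ : forall m : int, m < 0 -> 1 - A * Q ^ m \is a GRing.unit.
Hypothesis uZQ : forall m : int, 0 <= m -> 1 - Z * Q ^ m \is a GRing.unit.
Hypothesis uAZBQ : forall m : int, 0 <= m ->
  1 - (A^-1 * Z^-1 * B) * Q ^ m \is a GRing.unit.
Hypotheses (normZ : `|Z| < 1) (normAZB : `|A^-1 * Z^-1 * B| < 1).

Let uQn n : Q ^+ n \is a GRing.unit. Proof. exact: unitrX. Qed.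

Let uAn n : 1 - A * Q ^- n.+1 \is a GRing.unit.
Proof. by have := uAQ (isT : - n.+1%:Z < 0). Qed.

Let uBn n : 1 - B * Q ^- n.+1 \is a GRing.unit.
Proof. exact: (uBQ (- n.+1%:Z)). Qed.

Let uZA : Z * A \is a GRing.unit. Proof. by rewrite unitrMl. Qed.

Let ZAV : (Z * A)^-1 = A^-1 * Z^-1. Proof. by rewrite invrM. Qed.

Let denomE n : Z * Q ^+ n - Z * A = Z * (1 - A * Q ^- n) * Q ^+ n.
Proof. by rewrite -mulrA mulrBl mul1r mulrVK// mulrBr. Qed.

Let numE n : Q ^+ n - B = (1 - B * Q ^- n) * Q ^+ n.
Proof. by rewrite mulrBl mul1r mulrVK. Qed.

Let udenom n : Z * Q ^+ n.+1 - Z * A \is a GRing.unit.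
Proof. by rewrite denomE !unitrMl. Qed.

Let neg_factorE n : (Z * ((1 - A * Q ^- n.+1) * (1 - B * Q ^- n.+1)^-1))^-1 =
  (Q ^+ n.+1 - B) * (Z * Q ^+ n.+1 - Z * A)^-1.
Proof.
rewrite numE denomE invrM// ?invrM ?invrK ?unitrMl ?unitrV//.
by rewrite !mulrA mulrK.
Qed.

Let QZA : GRing.comm Q (Z * A). Proof. exact: commrM. Qed.

Let BZA : GRing.comm B (Z * A). Proof. exact: commrM. Qed.

(** This is (Q;Q)_n / (B;Q)_n. The statements interleave its factors with those of another product;
    as it commutes with everything in sight, it can be split off. *)
Let e (n : nat) : R := qfact_revI [tuple Q] [tuple B] Q 1 n.

Let eS n : e n.+1 = e n * ((1 - Q * Q ^+ n) * (1 - B * Q ^+ n)^-1).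
Proof. by rewrite /e qfact_revIS big_ord1 mul1r. Qed.

Let comm_e x n : GRing.comm x Q -> GRing.comm x B -> GRing.comm x (e n).
Proof. by move=> xQ xB; apply: comm_qfact_revI => // [i|i|]; rewrite ?ord1//; exact: commr1. Qed.

Lemma ramanujan_revI (L := qfact_revI [tuple A] [tuple B] Q Z)
    (P1 := qfact_revII [tuple Z * A] [tuple Z] Q 1)
    (P2 := qfact_revI [tuple A^-1 * Z^-1 * Q] [tuple Z * A^-1 * Z^-1 * Q] Q 1)
    (P3 := qfact_revII [tuple Z * A^-1 * Z^-1 * B; Q] [tuple A^-1 * Z^-1 * B; B] Q 1) :
  [/\ bilateral_cvg L, cvg_infty P1, cvg_infty P2, cvg_infty P3
    & psi_revI A B Q Z = at_infty P1 * at_infty P2 * at_infty P3].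
Proof.
pose p3 := fun n : nat =>
  qfact_revII [tuple Z * A^-1 * Z^-1 * B] [tuple A^-1 * Z^-1 * B] Q 1 n.
have aB : admissible Q Z (Z * A) B.
  by split=> [|n]; [split=> //; exact: commr_sym|exact: (uBQ n)].
have [|||||||||||||cL [c1 c2 c3 ce] eL] := @bilateral_sum_eval K R Q Z (Z * A)
  Q_to0 QZ QZA uZA normZ
  (fun n => uZQ (isT : 0 <= n%:Z)) udenom B L (fun n : nat => P1 n) (fun n : nat => P2 n) p3 e aB.
- by rewrite ZAV.
- by move=> n; rewrite ZAV; exact: (uAZBQ (isT : 0 <= n%:Z)).
- exact: qfact_revI0.
- move=> n; rewrite /L qfact_revIS big_ord1; congr (_ * _).
  by rewrite mulrA mulrBr mulr1 [Z * (_ * _)]mulrA.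
- by move=> n; rewrite /L qfact_revIN big_ord1 neg_factorE.
- exact: qfact_revII0.
- by move=> n; rewrite /P1 qfact_revIIS big_ord1 mul1r.
- exact: qfact_revI0.
- by move=> n; rewrite /P2 qfact_revIS big_ord1 mul1r ZAV !mulrA.
- exact: qfact_revII0.
- by move=> n; rewrite /p3 qfact_revIIS big_ord1 mul1r ZAV !mulrA.
- exact: qfact_revI0.
- exact: eS.
have P3E n : P3 n%:Z = p3 n * e n.
  elim: n => [|n IH]; first by rewrite /P3 /p3 /e !qfact_revII0 qfact_revI0 mulr1.
  have p3c x : GRing.comm x Q -> GRing.comm x B -> GRing.comm x A -> GRing.comm x Z ->
      GRing.comm x (p3 n).
    move=> xQ xB xA xZ; have xAV := commrV xA; have xZV := commrV xZ.
    by apply: comm_qfact_revII => // [i|i|]; rewrite ?ord1/=; do ?[exact: commr1|apply: commrM].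
  have Qp : GRing.comm (p3 n) Q by exact/commr_sym/p3c.
  have Bp : GRing.comm (p3 n) B by apply/commr_sym/p3c => //; exact: commr_sym.
  rewrite /P3 qfact_revIIS -/P3 IH eS /p3 qfact_revIIS -/p3 !mul1r big_ord1 big_ord_recl big_ord1.
  set c := (1 - Q * Q ^+ n) * (1 - B * Q ^+ n)^-1.
  have cP x : GRing.comm x Q -> GRing.comm x B -> GRing.comm x c.
    by move=> xQ xB; apply: commrM; [|apply: commrV]; exact: (comm_1subMexpz n%:Z).
  set w := (1 - Z * A^-1 * Z^-1 * B * Q ^+ n) * (1 - A^-1 * Z^-1 * B * Q ^+ n)^-1.
  change (w * c * (p3 n * e n) = w * p3 n * (e n * c)).
  rewrite -!(mulrA w); congr (_ * _); rewrite -cP; last first.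
  - apply/commr_sym/commrM; [exact: commr_sym|apply: comm_e => //; exact: commr_sym].
  - by apply/commr_sym/commrM; [exact: commr_sym|exact: comm_e].
  by rewrite -mulrA.
have cP3 : (fun n : nat => P3 n) @ \oo --> limn p3 * limn e.
  by under eq_fun do rewrite P3E; exact: banach_cvgM.
split; [exact: cL|exact: c1|exact: c2|exact: cvgP cP3|].
by rewrite /at_infty (cvg_lim _ cP3)// mulrA -eL.
Qed.

Lemma ramanujan_revII (L := qfact_revII [tuple A] [tuple B] Q Z)
    (P1 := qfact_II [tuple A^-1 * B] [tuple A^-1 * Z^-1 * B] Q 1)
    (P2 := qfact_revII [tuple Q; A^-1 * Z^-1 * Q] [tuple A^-1 * Q; B] Q 1)
    (P3 := qfact_II [tuple Z * A] [tuple Z] Q 1) :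
  [/\ bilateral_cvg L, cvg_infty P1, cvg_infty P2, cvg_infty P3
    & psi_revII A B Q Z = at_infty P1 * at_infty P2 * at_infty P3].
Proof.
(* Regrouped from [P2]: in the factors u w1 w2 v of one step, the outer pair u, v belongs to [e] and
   the inner pair w1, w2 is the step of [p2]. None of the shifted factorials has this shape, with
   denominators first and growth on the left. *)
pose p2 (n : nat) : R := iteri n (fun i (x : R) =>
  (1 - A^-1 * Q * Q ^+ i)^-1 * (1 - A^-1 * Z^-1 * Q * Q ^+ i) * x) 1.
have qn x n : GRing.comm Q x -> Q ^+ n * x = x * Q ^+ n.
  by move=> Qx; apply/esym/commrX/esym.
have QAV : GRing.comm Q A^-1 := commrV QA.
have QZV : GRing.comm Q Z^-1 := commrV QZ.
have BAV : GRing.comm B A^-1 := commrV BA.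
have BZV : GRing.comm B Z^-1 := commrV BZ.
have BD : B * (A^-1 * Z^-1) = A^-1 * Z^-1 * B by apply: commrM.
have cB x n : GRing.comm x Q -> GRing.comm x B -> GRing.comm x (1 - B * Q ^+ n).
  by move=> xQ xB; exact: (comm_1subMexpz n%:Z).
have posE n : Z * ((1 - A * Q ^+ n) * (1 - B * Q ^+ n)^-1) =
    (1 - Q ^+ n * B)^-1 * (Z - Q ^+ n * (Z * A)).
  rewrite !qn// mulrA mulrBr mulr1 [Z * (_ * _)]mulrA; apply/commrV/cB; apply/commr_sym.
    by apply: commrB => //; apply: commrM => //; exact: commrX.
  by apply: commrB => //; apply: commrM => //; exact/commrX/commr_sym.
have negE n : (Z * ((1 - A * Q ^- n.+1) * (1 - B * Q ^- n.+1)^-1))^-1 =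
    (Q ^+ n.+1 * Z - Z * A)^-1 * (Q ^+ n.+1 - B).
  rewrite neg_factorE qn//; apply/commrV/commr_sym.
  apply: commrB.
    by apply: commrX; apply/commr_sym/commrB => //; apply: commrM => //; exact: commrX.
  by apply/commr_sym/commrB => //; apply: commrM => //; exact/commrX/commr_sym.
have p2E n : (1 - A^-1 * Q * Q ^+ n)^-1 * (1 - A^-1 * Z^-1 * Q * Q ^+ n) =
    (1 - Q ^+ n * (Q * (A^-1 * Z^-1 * Z)))^-1 * (1 - Q ^+ n * (Q * (A^-1 * Z^-1))).
  have QAZ : GRing.comm Q (A^-1 * Z^-1) by exact: commrM.
  by rewrite mulrVK// QAV QAZ !qn//; exact: commrM.
have P1E n : (1 - A^-1 * Z^-1 * B * Q ^+ n)^-1 * (1 - A^-1 * B * Q ^+ n) =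
    (1 - Q ^+ n * (B * (Z * A)^-1))^-1 * (1 - Q ^+ n * (B * ((Z * A)^-1 * Z))).
  by rewrite ZAV mulrVK// BAV BD !qn//; do ?[apply: commrM => //].
have eE n : e n * ((1 - Q * Q ^+ n) * (1 - B * Q ^+ n)^-1) =
    (1 - Q ^+ n * B)^-1 * (1 - Q ^+ n * Q) * e n.
  rewrite !qn//; have uQ' : GRing.comm (1 - Q * Q ^+ n) Q.
    by apply/commr_sym; exact: (comm_1subMexpz n%:Z).
  have uB' : GRing.comm (1 - Q * Q ^+ n) B.
    by apply/commr_sym; exact: (comm_1subMexpz n%:Z).
  rewrite -(commrV (cB _ n uQ' uB')); apply/commr_sym/comm_e; apply/commr_sym.
    apply: commrM; first exact: commr_sym.
    by apply: commrV; exact: cB.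
  by apply: commrM; [exact: commr_sym|apply: commrV; apply: cB => //; exact: commr_sym].
have aB : @admissible K (converse_banach R) Q Z (Z * A) B.
  split=> [|n]; first by split.
  by rewrite converse_expE converse_mulE converse_unitE qn//; exact: (uBQ n).
have cQ_to0 : @GRing.exp (converse_banach R) Q @ \oo --> (0 : converse_banach R).
  rewrite [X in X @ _](_ : _ = fun n : nat => Q ^+ n) //.
  by apply/funext => n; rewrite converse_expE.
(* Reversal exchanges the outer products, so [P3] plays the part of p1 and [P1] that of p3. In this
   algebra C D^-1 reads A^-1 Z^-1 Z = A^-1, whence the parameters A^-1 Q and A^-1 B. *)
have [||||||||||||||||cL [c1 c2 c3 ce] eL] := (fun uD uC uCD => @bilateral_sum_eval K
  (converse_banach R) Q Z (Z * A) cQ_to0 (esym QZ) (esym QZA) uD normZ uC uCD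
  B L (fun n : nat => P3 n) p2 (fun n : nat => P1 n) e aB).
- by rewrite converse_unitE.
- move=> n; rewrite converse_expE converse_mulE converse_unitE qn//.
  exact: (uZQ (isT : 0 <= n%:Z)).
- by move=> n; rewrite converse_expE converse_mulE converse_unitE qn//; exact: udenom.
- by rewrite converse_invE converse_mulE ZAV BD.
- move=> n; rewrite converse_expE converse_invE !converse_mulE converse_unitE ZAV BD qn.
    exact: (uAZBQ (isT : 0 <= n%:Z)).
  by do ?[apply: commrM => //].
- exact: (qfact_revII0 [tuple A] [tuple B] Q Z).
- move=> n; rewrite /L qfact_revIIS big_ord1 converse_expE converse_invE !converse_mulE.
  by congr (_ * _); exact: posE.
- move=> n; rewrite /L qfact_revIIN big_ord1 !converse_expE converse_invE !converse_mulE.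
  by congr (_ * _); exact: negE.
- exact: (qfact_II0 [tuple Z * A] [tuple Z] Q 1).
- move=> n; rewrite /P3 qfact_IIS big_ord1 mulr1 converse_expE converse_invE !converse_mulE.
  by rewrite !qn.
- by [].
- move=> n; rewrite /p2 /= converse_expE !converse_invE !converse_mulE ZAV.
  by congr (_ * _); exact: p2E.
- exact: (qfact_II0 [tuple A^-1 * B] [tuple A^-1 * Z^-1 * B] Q 1).
- move=> n; rewrite /P1 qfact_IIS big_ord1 mulr1 !converse_expE !converse_invE !converse_mulE.
  by congr (_ * _); exact: P1E.
- exact: (qfact_revI0 [tuple Q] [tuple B] Q 1).
- move=> n; rewrite eS !converse_expE !converse_invE !converse_mulE.
  exact: eE.
have P2E n : P2 n%:Z = e n * p2 n.
  elim: n => [|n IH]; first by rewrite /P2 /p2 /e !qfact_revII0 qfact_revI0 mulr1.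
  rewrite /P2 qfact_revIIS -/P2 IH eS mul1r big_ord_recl big_ord1.
  set u := 1 - Q * Q ^+ n; set v := (1 - B * Q ^+ n)^-1.
  set w1 := (1 - A^-1 * Q * Q ^+ n)^-1; set w2 := 1 - A^-1 * Z^-1 * Q * Q ^+ n.
  change (u * w1 * (w2 * v) * (e n * p2 n) = e n * (u * v) * (w1 * w2 * p2 n)).
  have cw x : GRing.comm x Q -> GRing.comm x A^-1 -> GRing.comm x Z^-1 -> GRing.comm x (w1 * w2).
    move=> xQ xA xZ; apply: commrM; [apply: commrV|]; apply: (comm_1subMexpz n%:Z) => //.
      exact: commrM.
    by do ?[apply: commrM => //].
  have Qw := cw Q erefl QAV QZV; have Bw := cw B (commr_sym QB) BAV BZV.
  have vw : GRing.comm (w1 * w2) v by apply/commrV/cB; exact: commr_sym.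
  have ew : GRing.comm (w1 * w2) (e n) by apply: comm_e; exact: commr_sym.
  have euv : GRing.comm (u * v) (e n).
    apply: comm_e; apply/commr_sym/commrM; first exact: (comm_1subMexpz n%:Z).
    - exact/commrV/cB.
    - by apply: (comm_1subMexpz n%:Z) => //; exact: commr_sym.
    - by apply/commrV/cB => //; exact: commr_sym.
  rewrite -euv -(mulrA u w1) (mulrA w1 w2) vw (mulrA u v) -(mulrA (u * v) (w1 * w2)).
  by rewrite (mulrA (w1 * w2) (e n)) ew -(mulrA (e n)) (mulrA (u * v) (e n)).
have cP2 : (fun n : nat => P2 n) @ \oo --> limn e * limn p2.
  by under eq_fun do rewrite P2E; exact: banach_cvgM.
have eP1n n : e n * P1 n%:Z = P1 n%:Z * e n.
  apply/esym/comm_e; apply/commr_sym/comm_qfact_II => [i|i||]; rewrite ?ord1;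
    do ?[exact: commr1|exact: commr_sym|apply: commrM => //].
(* Reversal yields the order e, P1, p2, P3; moving [e] past [P1] lets it merge with [p2] into
   [P2]. *)
have eP1 : limn e * limn (fun n : nat => P1 n) = limn (fun n : nat => P1 n) * limn e.
  have c4 : (fun n : nat => e n * P1 n) @ \oo --> limn (fun n : nat => P1 n) * limn e.
    rewrite (_ : (fun n : nat => _) = fun n : nat => P1 n * e n); first exact: banach_cvgM.
    by apply/funext => n; exact: eP1n.
  have c5 : (fun n : nat => e n * P1 n) @ \oo --> limn e * limn (fun n : nat => P1 n).
    exact: banach_cvgM.
  by apply: cvg_unique c5 c4.
split; [exact: cL|exact: c3|exact: cvgP cP2|exact: c1|].
rewrite /at_infty (cvg_lim _ cP2)// mulrA -eP1 -!mulrA.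
exact: eL.
Qed.

End Ramanujan.

Theorem theorem3p4 (K : realType) (R : banachAlgType K) (A B Z Q : R)
  (* Q and B commute with each of the other parameters *)
  (QA : GRing.comm Q A) (QB : GRing.comm Q B) (QZ : GRing.comm Q Z)
  (BA : GRing.comm B A) (BZ : GRing.comm B Z)
  (* the base: Q ^+ n tends to 0 (e.g. `|Q| < 1) *)
  (Q_to0 : (Q ^+ n) @[n --> \oo] --> (0 : R))
  (* existence of the inverses that are written in the statement *)
  (uQ : Q \is a GRing.unit) (uA : A \is a GRing.unit) (uZ : Z \is a GRing.unit)
  (uBQ : forall m : int, 1 - B * Q ^ m \is a GRing.unit)
  (uAQ : forall m : int, m < 0 -> 1 - A * Q ^ m \is a GRing.unit)
  (uZQ : forall m : int, 0 <= m -> 1 - Z * Q ^ m \is a GRing.unit)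
  (uZAZQ : forall m : int, 0 <= m ->
     1 - (Z * A^-1 * Z^-1 * Q) * Q ^ m \is a GRing.unit)
  (uAZBQ : forall m : int, 0 <= m ->
     1 - (A^-1 * Z^-1 * B) * Q ^ m \is a GRing.unit)
  (uAQQ : forall m : int, 0 <= m ->
     1 - (A^-1 * Q) * Q ^ m \is a GRing.unit)
  (normZ : `|Z| < 1) (normAZB : `|A^-1 * Z^-1 * B| < 1) :
  let I : R := 1 in
  (* reversed type I *)
  (let L := qfact_revI [tuple A] [tuple B] Q Z in
   let P1 := qfact_revII [tuple Z * A] [tuple Z] Q I in
   let P2 := qfact_revI [tuple A^-1 * Z^-1 * Q] [tuple Z * A^-1 * Z^-1 * Q] Q I in
   let P3 := qfact_revII [tuple Z * A^-1 * Z^-1 * B; Q]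
                         [tuple A^-1 * Z^-1 * B; B] Q I in
   [/\ bilateral_cvg L, cvg_infty P1, cvg_infty P2, cvg_infty P3
     & psi_revI A B Q Z = at_infty P1 * at_infty P2 * at_infty P3])
  /\
  (* reversed type II *)
  (let L := qfact_revII [tuple A] [tuple B] Q Z in
   let P1 := qfact_II [tuple A^-1 * B] [tuple A^-1 * Z^-1 * B] Q I in
   let P2 := qfact_revII [tuple Q; A^-1 * Z^-1 * Q] [tuple A^-1 * Q; B] Q I in
   let P3 := qfact_II [tuple Z * A] [tuple Z] Q I in
   [/\ bilateral_cvg L, cvg_infty P1, cvg_infty P2, cvg_infty P3
     & psi_revII A B Q Z = at_infty P1 * at_infty P2 * at_infty P3]).
Proof.
by split; [apply: ramanujan_revI|apply: ramanujan_revII].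
Qed.
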